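(* Let $T$ be a universal theory of graphs such that its class $\mathcal{M}[T]$ of finite models is closed under substitutions. Then $T$ has the weakly random Erdős–Hajnal property if and only if $\mathcal{M}[T]$ is primally almost finite.
   Context: A universal theory of graphs $T$ is identified with its class $\mathcal{M}[T]$ of finite models, a family of finite graphs closed under isomorphism and induced subgraphs. A graphon of $T$ (limit of $T$) is a graphon $W$ that is the limit of a convergent sequence of graphs in $\mathcal{M}[T]$ (i.e., induced densities of every finite graph converge to those of $W$). For a graphon $W$ ($W\colon X\times X\to[0,1]$ symmetric measurable on an atomless standard probability space), $Q(W)$ is the set of finite graphs of positive induced density in $W$; a subgraphon of $W$ is the graphon $W$ considered on $(X,\mu_f)$, $\mu_f(B)=\int_Bf\,d\mu/\int f\,d\mu$, for a measurable $f\colon X\to[0,1]$ with $\int f>0$; $W$ is weakly random if $Q(W')=Q(W)$ for every subgraphon $W'$ of $W$. $T$ has the weakly random Erdős–Hajnal property if every graphon of $T$ has a weakly random subgraphon. The substitution $F_1^{v\to F_2}$ replaces the vertex $v$ of $F_1$ by a copy of $F_2$ whose vertices are all adjacent to exactly the neighbours of $v$; a graph $F$ is prime if it is not of the form $F_1^{v\to F_2}$ with $|F_1|,|F_2|<|F|$. A family of graphs is almost finite if it contains no infinite antichain in the induced-subgraph order, and primally almost finite if its set of prime members is almost finite. *)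

(* Defs.v *)
From HB Require Import structures.
From mathcomp Require Import all_boot all_order all_algebra.
From mathcomp Require Import all_classical all_reals all_analysis.

Set Implicit Arguments.
Unset Strict Implicit.
Unset Printing Implicit Defensive.

Import Order.TTheory GRing.Theory Num.Theory.
Import numFieldNormedType.Exports.

Local Open Scope classical_set_scope.
Local Open Scope ring_scope.

(** * Finite graphs *)

(* Up to isomorphism, the vertex set is {0, ..., n-1}. *)
Record graph := Graph {
  gorder : nat;
  edge : rel 'I_gorder;
  edge_sym : symmetric edge;
  edge_irr : irreflexive edge }.

Definition vertex (F : graph) : finType := 'I_(gorder F).
Coercion vertex : graph >-> finType.

(* [embeds F G]: F is isomorphic to an induced subgraph of G. *)
Definition embeds (F G : graph) : Prop :=
  exists f : F -> G,
    injective f /\ forall u v : F, edge (f u) (f v) = edge u v.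

Definition iso (F G : graph) : Prop :=
  exists f : F -> G,
    bijective f /\ forall u v : F, edge (f u) (f v) = edge u v.

Section Substitution.
Variables (F1 : graph) (v : F1) (F2 : graph).

Definition subst_vertex : finType := ({x : F1 | x != v} + F2)%type.

Definition subst_edge : rel subst_vertex := fun a b =>
  match a, b with
  | inl x, inl y => edge (val x) (val y)
  | inl x, inr _ => edge (val x) v
  | inr _, inl y => edge v (val y)
  | inr x, inr y => edge x y
  end.

Definition subst_edge_ord : rel 'I_#|subst_vertex| :=
  fun i j => subst_edge (enum_val i) (enum_val j).

Lemma subst_edge_sym : symmetric subst_edge_ord.
Proof.
move=> i j; rewrite /subst_edge_ord.
by case: (enum_val i) (enum_val j) => [x|x] [y|y] /=; rewrite edge_sym.
Qed.

Lemma subst_edge_irr : irreflexive subst_edge_ord.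
Proof.
by move=> i; rewrite /subst_edge_ord; case: (enum_val i) => x /=; rewrite edge_irr.
Qed.

(* The graph [subst_edge], with its vertices numbered by [enum_val]. *)
Definition subst : graph := Graph subst_edge_sym subst_edge_irr.

End Substitution.

Definition prime_graph (F : graph) : Prop :=
  ~ exists (F1 : graph) (v : F1) (F2 : graph),
      [/\ (gorder F1 < gorder F)%N, (gorder F2 < gorder F)%N & iso F (subst v F2)].

(* An infinite antichain is given by an injective enumeration of (countably
   many of) its members; incomparability makes them pairwise non-isomorphic. *)
Definition almost_finite (A : set graph) : Prop :=
  ~ exists G : nat -> graph,
      (forall n, A (G n)) /\ (forall i j, i <> j -> ~ embeds (G i) (G j)).

Definition primally_almost_finite (A : set graph) : Prop :=
  almost_finite (A `&` prime_graph).

Definition closed_under_substitution (A : set graph) : Prop :=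
  forall (F1 : graph) (v : F1) (F2 : graph), A F1 -> A F2 -> A (subst v F2).

(* A universal theory of graphs, identified with its class of finite models.
   Closure under [embeds] is closure under isomorphism and induced subgraphs. *)
Record universal_theory := UniversalTheory {
  models : set graph;
  models_hereditary : forall F G, embeds F G -> models G -> models F }.

(** * Graphons *)

Section Spaces.
Context {R : realType} {d : measure_display} {X : measurableType d}.

Definition atomless (mu : probability X R) : Prop :=
  forall A, measurable A -> (0 < mu A)%E ->
    exists B, [/\ measurable B, B `<=` A, (0 < mu B)%E & (mu B < mu A)%E].

End Spaces.

(* X is isomorphic, as a measurable space, to a Borel subset of the reals
   (namely the image of f; taking A = setT shows that this image is Borel). *)
Definition standard_borel (R : realType) (d : measure_display)
    (X : measurableType d) : Prop :=
  exists f : X -> R,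
    [/\ measurable_fun setT f, injective f &
        forall A, measurable A -> measurable (f @` A)].

Record graphon (R : realType) (d : measure_display) (X : measurableType d) :=
  Graphon {
    gmeas : probability X R;
    gfun :> X -> X -> R;
    graphon_standard : standard_borel R X;
    graphon_atomless : atomless gmeas;
    graphon_sym : forall x y, gfun x y = gfun y x;
    graphon_measurable : measurable_fun setT (fun p : X * X => gfun p.1 p.2);
    graphon_itv : forall x y, 0 <= gfun x y <= 1 }.

Section Densities.
Context {R : realType} {d : measure_display} {X : measurableType d}.

(* Integral over X^n with respect to the n-fold product of mu, written as an
   iterated integral; by Tonelli's theorem they agree for g >= 0 measurable. *)
Fixpoint integral_tuple (mu : probability X R) (n : nat) :
    (n.-tuple X -> \bar R) -> \bar R :=
  match n with
  | 0 => fun g => g [tuple]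
  | n'.+1 => fun g =>
      (\int[mu]_x integral_tuple mu (fun t => g [tuple of x :: t]))%E
  end.

(* Densities are of labelled copies: the probability that a uniformly random
   injection F -> G is an induced embedding, and that |F| independent points
   sampled from W span F. The density of unlabelled copies is, in both cases,
   this number multiplied by |F|! / |Aut F|. *)
Definition graph_density (F G : graph) : R :=
  #|[set f : {ffun F -> G} |
      injectiveb f && [forall u, forall v, edge (f u) (f v) == edge u v]]|%:R
  / (gorder G ^_ gorder F)%:R.

Definition graphon_density (F : graph) (W : graphon R X) : \bar R :=
  integral_tuple (gmeas W) (fun t : (gorder F).-tuple X =>
    (\prod_(p : 'I_(gorder F) * 'I_(gorder F) | (p.1 < p.2)%N)
       let w := W (tnth t p.1) (tnth t p.2) in
       if edge p.1 p.2 then w else 1 - w)%:E).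

Definition Q (W : graphon R X) : set graph :=
  [set F | (0 < graphon_density F W)%E].

Definition is_subgraphon (W' W : graphon R X) : Prop :=
  (forall x y, W' x y = W x y) /\
  exists f : X -> R,
    [/\ measurable_fun setT f,
        forall x, 0 <= f x <= 1,
        0 < \int[gmeas W]_x f x &
        forall B, measurable B ->
          gmeas W' B = (\int[gmeas W]_(x in B) f x / \int[gmeas W]_x f x)%:E].

Definition weakly_random (W : graphon R X) : Prop :=
  forall W' : graphon R X, is_subgraphon W' W -> Q W' = Q W.

(* Convergence of all densities forces the number of vertices of G n to tend
   to infinity: graphs F with more vertices than G n have density 0 in G n. *)
Definition is_graphon_of (T : universal_theory) (W : graphon R X) : Prop :=
  exists G : nat -> graph,
    (forall n, models T (G n)) /\
    forall F : graph,
      ((graph_density F (G n))%:E @[n --> \oo] --> graphon_density F W)%E.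

End Densities.

Definition weakly_random_erdos_hajnal (R : realType) (T : universal_theory) :
    Prop :=
  forall (d : measure_display) (X : measurableType d) (W : graphon R X),
    is_graphon_of T W ->
    exists W' : graphon R X, is_subgraphon W' W /\ weakly_random W'.

(* Main.v *)
Require Import Defs.
From mathcomp Require Import all_boot all_order all_algebra zify.
From mathcomp Require Import all_classical all_reals all_analysis.
From mathcomp Require Import measurable_realfun.

(** For a set [A] of points of a graphon [W], say that [F] is positive in [A]
    when the tuples of points of [A] that span [F] with positive probability do
    not form a null set. This depends on the measure only through its null sets,
    so every subgraphon of [W] contains exactly the graphs positive in some
    non-null [A], and all non-null [A] occur.

    If the primes of the theory are almost finite, some positive set [A] has a
    minimal set of positive primes: a strictly decreasing sequence would give a
    bad sequence of primes, hence an infinite antichain. Positivity of [F1] in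
    [A] and of [F2] in all positive subsets of [A] gives positivity of
    [F1^(v -> F2)] in [A], so by induction on [F] through its decomposition into
    primes, [F] positive in [A] is positive in every positive subset of [A].

    Conversely let [G] be an infinite antichain of primes, and let [H] list
    every [G k] exactly [|G k|] times in a row. Blow up infinitely often: the
    points of [[0, 1]] are given by their mixed-radix digits [x_0, x_1, ...] with
    [x_n] a vertex of [H n], and two points are adjacent when their first
    distinct digits are. This is the limit of the iterated lexicographic products
    [H 0 [H 1 [... [H n]]]]. A set in which no [G k] is positive misses a child
    of every cylinder, so it has measure at most
    [\prod_n (1 - 1/|H n|) = 0]; thus a subgraphon contains some [G k], but its
    restriction to a cylinder beyond the last occurrence of [G k] does not,
    because a prime graph embeds in a lexicographic product only through one of
    the factors. *)

Set Implicit Arguments.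
Unset Strict Implicit.
Unset Printing Implicit Defensive.

Import Order.TTheory GRing.Theory Num.Theory.
Import numFieldNormedType.Exports.

Local Open Scope classical_set_scope.
Local Open Scope ring_scope.

(** * Null sets of tuples *)

Section NullRelations.
Context {R : realType} {d : measure_display} {X : measurableType d}.
Implicit Types (mu nu : probability X R) (S : seq X -> Prop).

(** Iterated nullity, with the first coordinate outermost. Stated with [negligible], it makes sense
    for an arbitrary [S]; for measurable [S] it is nullity for the product measure, by Tonelli. *)
Fixpoint null mu n S : Prop :=
  match n with
  | 0 => ~ S [::]
  | n'.+1 => mu.-negligible [set x | ~ null mu n' (fun s => S (x :: s))]
  end.

Lemma null_false mu n S : (forall s, size s = n -> ~ S s) -> null mu n S.
Proof.
elim: n S => [|n IH] S hS /=; first exact: hS.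
rewrite (_ : [set x | _] = set0); first exact: negligible_set0.
apply/seteqP; split=> // x /=; apply.
by apply: IH => s hs; apply: hS; rewrite /= hs.
Qed.

Lemma null_sub mu n S S' : (forall s, size s = n -> S s -> S' s) ->
  null mu n S' -> null mu n S.
Proof.
elim: n S S' => [|n IH] S S' h /=; first by move=> h0 /(h [::] erefl).
apply: negligibleS => x /= hx hn; apply: hx; apply: IH hn => s hs.
by apply: h; rewrite /= hs.
Qed.

Lemma null_cat mu n m S :
  null mu (n + m) S <-> null mu n (fun y => ~ null mu m (fun x => S (y ++ x))).
Proof.
elim: n S => [|n IH] S /=; first by split=> [h /(_ h)|/contrapT].
suff -> : [set x | ~ null mu (n + m) (fun s => S (x :: s))] =
  [set x | ~ null mu n (fun s => ~ null mu m (fun x0 => S (x :: s ++ x0)))] by [].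
by apply/seteqP; split=> x /=; apply: contra_not; rewrite IH.
Qed.

Lemma null_box mu n (B : nat -> set X) (x0 : X) :
  (forall i, (i < n)%N -> ~ mu.-negligible (B i)) ->
  ~ null mu n (fun s => forall i, (i < n)%N -> B i (nth x0 s i)).
Proof.
elim: n B => [|n IH] B hB /=; first by apply.
move=> hn; apply: (hB 0%N isT); apply: negligibleS hn => x /= Bx hx.
apply: (IH (fun i => B i.+1)) => [i /(hB i.+1) //|].
by apply: null_sub hx => s _ h [|i] //=; exact: h.
Qed.

(** One use of the hypothesis per coordinate; a coordinate outside [A] makes the restricted
    predicate empty. *)
Lemma null_restrict mu nu A n S :
  (forall N, nu.-negligible N <-> mu.-negligible (N `&` A)) ->
  null nu n S <-> null mu n (fun s => S s /\ {in s, forall x, A x}).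
Proof.
move=> hA; elim: n S => [|n IH] S /=.
  by split=> [h []//|h hS]; apply: h.
rewrite hA.
suff -> : [set x | ~ null nu n (fun s => S (x :: s))] `&` A =
  [set x | ~ null mu n (fun s => S (x :: s) /\
     {in x :: s, forall y, A y})] by [].
apply/seteqP; split=> x /=.
  move=> [hx Ax] h; apply: hx; rewrite IH; apply: null_sub h => s _ [h1 h2].
  by split=> // y; rewrite inE => /predU1P[->//|]; exact: h2.
move=> hx; split; last first.
  apply: contrapT => nAx; apply: hx; apply: null_false => s _ [_ h].
  by apply: nAx; apply: h; rewrite inE eqxx.
move=> h; apply: hx; move: h; rewrite IH; apply: null_sub => s _ [h1 h2].
by split=> // y ys; apply: h2; rewrite inE ys orbT.
Qed.

End NullRelations.

(** * Measurability of null sections and exchange of coordinates *)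

Section NullMeasurability.
Context {R : realType} {d : measure_display} {X : measurableType d}.
Implicit Types (mu nu : probability X R) (S : seq X -> Prop).

Lemma measurable_preimage {d1 d2} {Y : measurableType d1} {Z : measurableType d2}
    (f : Y -> Z) (B : set Z) :
  measurable_fun setT f -> measurable B -> measurable (f @^-1` B).
Proof. by move=> mf mB; rewrite -[X in measurable X]setTI; exact: mf. Qed.

Lemma measurable_seq_preimage {d'} {Z : measurableType d'} (x0 : X) m
    (f : Z -> seq X) S :
  (forall z, size (f z) = m) ->
  (forall i, (i < m)%N -> measurable_fun setT (fun z => nth x0 (f z) i)) ->
  measurable [set t : m.-tuple X | S t] -> measurable [set z | S (f z)].
Proof.
move=> sf mf mS.
pose g z : m.-tuple X := Tuple (introT eqP (sf z)).
have mg : measurable_fun setT g.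
  apply/measurable_fun_tnthP => i; apply: eq_measurable_fun (mf i (ltn_ord i)).
  by move=> z _ /=; rewrite (tnth_nth x0).
exact: measurable_preimage mg mS.
Qed.

Lemma measurable_nth {d'} {Z : measurableType d'} (x0 : X) n (f : Z -> n.-tuple X) i :
  (i < n)%N -> measurable_fun setT f ->
  measurable_fun setT (fun z => nth x0 (f z) i).
Proof.
move=> ltin mf; have /measurable_fun_tnthP/(_ (Ordinal ltin)) := mf.
by apply: eq_measurable_fun => z _ /=; rewrite (tnth_nth x0).
Qed.

(** Induction on [n] with the parameter space [Z] left free: it absorbs the first coordinate, and
    what remains is whether a measurable section has nonzero measure. *)
Lemma measurable_null {d'} {Z : measurableType d'} mu n (S : Z -> seq X -> Prop) :
  measurable [set p : Z * n.-tuple X | S p.1 p.2] ->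
  measurable [set z | ~ null mu n (S z)].
Proof.
elim: n d' Z S => [|n IH] d' Z S mS /=.
  rewrite (_ : [set z | _] = (fun z : Z => (z, [tuple] : 0.-tuple X)) @^-1`
    [set p : Z * 0.-tuple X | S p.1 p.2]).
    apply: measurable_preimage mS.
    by apply: measurable_fun_pair => //; exact: measurable_cst.
  by apply/seteqP; split=> z /=; [exact: contrapT|move=> h; apply].
pose B := [set p : Z * X | ~ null mu n (fun s => S p.1 (p.2 :: s))].
have mB : measurable B.
  apply: (IH _ _ (fun p s => S p.1 (p.2 :: s))).
  pose g (q : Z * X * n.-tuple X) : Z * (n.+1).-tuple X :=
    (q.1.1, [the (n.+1).-tuple X of q.1.2 :: q.2]).
  have mg : measurable_fun setT g.
    apply: measurable_fun_pair; first exact: measurableT_comp.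
    by apply: measurable_cons => //; exact: measurableT_comp.
  exact: measurable_preimage mg mS.
rewrite (_ : [set z | _] = [set z | (mu \o xsection B) z != 0%E]).
  have := emeasurable_neq measurableT
    (measurable_fun_xsection mu mB) 0%E.
  by rewrite setTI.
have E z : [set x | ~ null mu n (fun s => S z (x :: s))] = xsection B z.
  by apply/seteqP; split=> x; rewrite /xsection /= inE.
apply/seteqP; split=> z /=; rewrite E.
  move=> h; apply/eqP => h0; apply: h; apply/negligibleP => //.
  exact: measurable_xsection.
move=> /eqP h h0; apply: h; apply/negligibleP => //.
exact: measurable_xsection.
Qed.

(** Tonelli for the indicator of [B]: both conditions say that [B] is null for the product
    measure. *)
Lemma negligible_swap mu (B : set (X * X)) : measurable B ->
  mu.-negligible [set x | ~ mu.-negligible [set y | B (x, y)]] ->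
  mu.-negligible [set y | ~ mu.-negligible [set x | B (x, y)]].
Proof.
move=> mB.
have Ex x : [set y | B (x, y)] = xsection B x.
  by apply/seteqP; split=> y; rewrite /xsection /= inE.
have Ey y : [set x | B (x, y)] = ysection B y.
  by apply/seteqP; split=> x; rewrite /ysection /= inE.
have mx x : measurable (xsection B x) by exact: measurable_xsection.
have my y : measurable (ysection B y) by exact: measurable_ysection.
have mfx : measurable_fun setT (mu \o xsection B : X -> \bar R) by exact: measurable_fun_xsection.
have mfy : measurable_fun setT (mu \o ysection B : X -> \bar R) by exact: measurable_fun_ysection.
have := @indic_fubini_tonelli _ _ _ _ _ mu mu B mB.
rewrite indic_fubini_tonelli_FE// indic_fubini_tonelli_GE//.
have abs0 (f : X -> \bar R) : (forall x, 0 <= f x)%E ->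
    (\int[mu]_x f x = \int[mu]_x `|f x|)%E.
  by move=> f0; apply: eq_integral => x _; rewrite gee0_abs.
rewrite [LHS]abs0; last by move=> x /=.
rewrite [RHS]abs0; last by move=> x /=.
move=> fub h.
have /(ae_eq_integral_abs mu measurableT mfx) h0 :
    ae_eq mu setT (mu \o xsection B) (cst 0%E).
  apply: negligibleS h => x /= hx h0; apply: hx => _.
  by apply: measure_negligible => //; rewrite -Ex.
move: fub; rewrite h0 => /esym/(ae_eq_integral_abs mu measurableT mfy).
apply: negligibleS => y /= hy h1; apply: hy.
by rewrite Ey; apply/negligibleP => //; exact: h1.
Qed.

Definition insert (i : nat) (x : X) (s : seq X) := take i s ++ x :: drop i s.

Lemma size_insert i x s : size (insert i x s) = (size s).+1.
Proof. by rewrite /insert size_cat /= addnS -size_cat cat_take_drop. Qed.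

Lemma nth_insert x0 i x s k : (i <= size s)%N ->
  nth x0 (insert i x s) k =
  if (k < i)%N then nth x0 s k else if k == i then x else nth x0 s k.-1.
Proof.
move=> his; rewrite /insert nth_cat size_takel//.
case: ltnP => [ki|]; first by rewrite nth_take.
rewrite leq_eqVlt => /predU1P[<-|ik]; first by rewrite subnn eqxx.
rewrite gtn_eqF// -(subnSK ik) /= nth_drop; congr nth.
by rewrite subnS; case: k ik => //= k; rewrite ltnS => ik; rewrite subSn //= subnKC.
Qed.

(** The hypothesis quantifies coordinate [i] first. By induction on [i], it is moved past each
    coordinate before it with [negligible_swap]. *)
Lemma null_insert (x0 : X) mu n i S : (i <= n)%N ->
  measurable [set t : (n.+1).-tuple X | S t] ->
  mu.-negligible [set x | ~ null mu n (fun s => S (insert i x s))] ->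
  null mu n.+1 S.
Proof.
elim: i n S => [|i IH] [|n] S //=.
rewrite ltnS => ilen mS h.
pose B := [set p : X * X | ~ null mu n (fun s => S (p.2 :: insert i p.1 s))].
have mB : measurable B.
  apply: (@measurable_null _ _ _ n (fun p s => S (p.2 :: insert i p.1 s))).
  apply: (@measurable_seq_preimage _ _ x0 n.+2
    (fun q : (X * X) * n.-tuple X => q.1.2 :: insert i q.1.1 q.2)) => //.
    by move=> q; rewrite /= size_insert size_tuple.
  case=> [_|k /= hk]; first exact: measurableT_comp.
  under eq_fun => q do rewrite nth_insert ?size_tuple//.
  case: ltnP => [ki|ik]; first by apply: measurable_nth => //; exact: leq_trans ki ilen.
  case: eqVneq => [_|ki]; first exact: measurableT_comp.
  apply: measurable_nth => //; case: k hk ik ki => [|k] hk ik ki //=.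
  by case: i ik ki {h B IH ilen}.
have /(negligible_swap mB) : mu.-negligible
    [set x | ~ mu.-negligible [set y | B (x, y)]].
  exact: h.
apply: negligibleS => y /= hy h1; apply: hy.
apply: (IH n (fun s => S (y :: s))) => //.
apply: (@measurable_seq_preimage _ _ x0 n.+2 (fun q : (n.+1).-tuple X => y :: q)) => //.
  by move=> q; rewrite /= size_tuple.
by case=> [_|k hk] /=; [exact: measurable_cst|apply: measurable_nth].
Qed.

(** By [null_insert] the position listed first can be quantified first; the others follow by
    induction on [fs]. This covers permuting coordinates and forgetting some of them. *)
Lemma null_map (x0 : X) mu n m (fs : seq nat) S :
  size fs = m -> uniq fs -> {in fs, forall i, (i < n)%N} ->
  measurable [set t : m.-tuple X | S t] ->
  null mu m S -> null mu n (fun s => S [seq nth x0 s i | i <- fs]).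
Proof.
elim: m n fs S => [|m IH] n [|i fs] S //=.
  by move=> _ _ _ _ h; apply: null_false.
case=> sfs /andP[ifs ufs] hfs mS h.
have /= ltin : (i < n)%N by apply: hfs; rewrite inE eqxx.
case: n ltin hfs => // n ltin hfs.
have hfs' k : k \in fs -> (k < n.+1)%N by move=> kfs; apply: hfs; rewrite inE kfs orbT.
apply: (@null_insert x0 _ _ i) => //.
  apply: (@measurable_seq_preimage _ _ x0 m.+1
    (fun t : (n.+1).-tuple X => nth x0 t i :: [seq nth x0 t i0 | i0 <- fs])) => //.
    by move=> z; rewrite /= size_map sfs.
  case=> [_|k /= hk]; first exact: measurable_nth.
  rewrite ltnS -sfs in hk.
  under eq_fun => z do rewrite (nth_map 0%N)//.
  by apply: measurable_nth => //; apply: hfs'; rewrite mem_nth.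
apply: negligibleS h => x /= hx h1; apply: hx.
have neq_i k : k \in fs -> k != i by move=> kfs; apply: contraNneq ifs => <-.
(* Removing position [i] renumbers every other position [k] as [unbump i k]. *)
apply: null_sub (IH n [seq unbump i k | k <- fs] (fun s => S (x :: s)) _ _ _ _ h1).
- move=> s sn; rewrite nth_insert ?sn// ltnn eqxx -map_comp.
  suff -> : [seq nth x0 (insert i x s) k | k <- fs] =
    [seq (nth x0 s \o unbump i) k | k <- fs] by [].
  apply/eq_in_map => k /neq_i ki /=; rewrite nth_insert ?sn// (negPf ki) /unbump.
  by case: ltngtP ki => //= ik _; rewrite ?subn0// subn1.
- by rewrite size_map.
- rewrite map_inj_in_uniq// => k l /neq_i ki /neq_i li.
  by move/(congr1 (bump i)); rewrite !unbumpKcond (negPf ki) (negPf li).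
- move=> _ /mapP[k kfs ->]; have := hfs' k kfs; have := neq_i k kfs.
  rewrite /unbump; case: (ltngtP i k) => // ik; last first.
    by move=> _ _; rewrite subn0; exact: leq_trans ik ltin.
  by case: k ik {kfs} => // k ik; rewrite subn1 => _.
apply: (@measurable_seq_preimage _ _ x0 m.+1 (fun t : m.-tuple X => x :: t)) => //.
  by move=> z; rewrite /= size_tuple.
by case=> [_|k hk] /=; [exact: measurable_cst|apply: measurable_nth].
Qed.

End NullMeasurability.

(** * Patterns of positive density *)

Section IteratedIntegral.
Context {R : realType} {d : measure_display} {X : measurableType d}.
Implicit Types (mu : probability X R).
Local Open Scope ereal_scope.

Lemma integral_tuple_ge0 mu n (g : n.-tuple X -> \bar R) :
  (forall t, 0 <= g t) -> 0 <= integral_tuple mu g.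
Proof.
elim: n g => [|n IH] g g0 /=; first exact: g0.
by apply: integral_ge0 => x _; apply: IH.
Qed.

(** As in [measurable_null], the free parameter space absorbs the first coordinate. *)
Lemma measurable_integral_tuple {d'} {Z : measurableType d'} mu n
    (h : Z -> n.-tuple X -> \bar R) :
  (forall z t, 0 <= h z t) ->
  measurable_fun setT (fun p : Z * n.-tuple X => h p.1 p.2) ->
  measurable_fun setT (fun z => integral_tuple mu (h z)).
Proof.
elim: n d' Z h => [|n IH] d' Z h h0 mh /=.
  have mg : measurable_fun setT (fun z : Z => (z, [tuple] : 0.-tuple X)).
    by apply: measurable_fun_pair => //; exact: measurable_cst.
  exact: (measurableT_comp mh mg).
have mf : measurable_fun setT (fun p : Z * X =>
    integral_tuple mu (fun t => h p.1 [tuple of p.2 :: t])).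
  apply: (IH _ _ (fun p t => h p.1 [tuple of p.2 :: t])) => //.
  have mg : measurable_fun setT (fun q : Z * X * n.-tuple X =>
      (q.1.1, [tuple of q.1.2 :: q.2])).
    apply: measurable_fun_pair; first exact: measurableT_comp.
    by apply: measurable_cons => //; exact: measurableT_comp.
  exact: (measurableT_comp mh mg).
have := @measurable_fun_fubini_tonelli_F _ _ _ _ _ mu _ mf.
by apply => p; apply: integral_tuple_ge0.
Qed.

Lemma measurable_tuple_cons n (x : X) :
  measurable_fun setT (fun t : n.-tuple X => [tuple of x :: t]).
Proof. by apply: measurable_cons => //; exact: measurable_cst. Qed.

Lemma measurable_integral_tuple_cons mu n (g : n.+1.-tuple X -> \bar R) :
  (forall t, 0 <= g t) -> measurable_fun setT g ->
  measurable_fun setT (fun x => integral_tuple mu (fun t => g [tuple of x :: t])).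
Proof.
move=> g0 mg; apply: measurable_integral_tuple => //.
have mc : measurable_fun setT (fun p : X * n.-tuple X => [tuple of p.1 :: p.2]).
  exact: measurable_cons.
exact: (measurableT_comp mg mc).
Qed.

Lemma le_integral_tuple mu n (g h : n.-tuple X -> \bar R) :
  (forall t, 0 <= g t) -> measurable_fun setT g -> measurable_fun setT h ->
  (forall t, g t <= h t) -> integral_tuple mu g <= integral_tuple mu h.
Proof.
elim: n g h => [|n IH] g h g0 mg mh gh /=; first exact: gh.
have h0 t : 0 <= h t by apply: le_trans (gh t).
apply: ge0_le_integral => //.
- by move=> x _; apply: integral_tuple_ge0.
- exact: measurable_integral_tuple_cons.
- exact: measurable_integral_tuple_cons.
- move=> x _; apply: IH => //; apply: measurableT_comp => //;
    exact: measurable_tuple_cons.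
Qed.

(** The vanishing criterion for integrals of nonnegative functions, one coordinate at a time. It
    links densities, which are integrals, to [null]. *)
Lemma integral_tuple_eq0 mu n (h : seq X -> \bar R) :
  (forall s, 0 <= h s) -> measurable_fun setT (fun t : n.-tuple X => h t) ->
  integral_tuple mu (fun t : n.-tuple X => h t) = 0 <->
  null mu n (fun s => h s != 0).
Proof.
elim: n h => [|n IH] h h0 mh /=; first by split=> [->|/negP/negPn/eqP]; rewrite ?eqxx.
pose g x := integral_tuple mu (fun t : n.-tuple X => h (x :: t)).
have g0 x : 0 <= g x by apply: integral_tuple_ge0.
have mg : measurable_fun setT g by apply: measurable_integral_tuple_cons mh.
rewrite (_ : integral _ _ _ = \int[mu]_x `|g x|); last first.
  by apply: eq_integral => x _; rewrite gee0_abs.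
rewrite ae_eq_integral_abs//.
have E x : g x = 0 <-> null mu n (fun s => h (x :: s) != 0).
  apply: IH => //; apply: (measurableT_comp mh); exact: measurable_tuple_cons.
split; apply: negligibleS => x /= hx h1; apply: hx; first by rewrite -E; exact: h1.
by move=> _; rewrite E.
Qed.

End IteratedIntegral.

(** * Tuples of points that realize a graph *)

Section Patterns.
Context {R : realType} {d : measure_display} {X : measurableType d}.
Variables (x0 : X) (W : X -> X -> R).
Implicit Types (mu : probability X R) (A : set X) (F : graph).

(** [e] gives the position of each vertex in [s], so that several graphs can share one tuple. The
    strict inequalities say that the factors of the density integrand are nonzero. *)
Definition realizes F (e : F -> nat) (s : seq X) : Prop :=
  forall u v : F, u != v ->
    let w := W (nth x0 s (e u)) (nth x0 s (e v)) in
    if edge u v then 0 < w else w < 1.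

Definition realizes_in A F (e : F -> nat) (s : seq X) : Prop :=
  realizes e s /\ {in s, forall x, A x}.

Definition positive_in mu A F : Prop :=
  ~ null mu (gorder F) (@realizes_in A F (@nat_of_ord _)).

Hypothesis mW : measurable_fun setT (fun p : X * X => W p.1 p.2).

Lemma measurable_forall {d'} {Z : measurableType d'} (I : finType) (P : I -> set Z) :
  (forall i, measurable (P i)) -> measurable [set z | forall i, P i z].
Proof.
move=> mP; rewrite (_ : [set z | _] = \bigcap_(i in setT) P i).
  by apply: fin_bigcap_measurable => //; exact: finite_finset.
by apply/seteqP; split=> z /= h i; [move=> _|]; exact: h.
Qed.

Lemma measurable_imply {d'} {Z : measurableType d'} (P : Prop) (A : set Z) :
  (P -> measurable A) -> measurable [set z | P -> A z].
Proof.
move=> mA; have [p|np] := pselect P.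
  rewrite (_ : mkset _ = A); first exact: mA.
  by apply/seteqP; split=> z /=; [apply|].
rewrite (_ : mkset _ = setT); first exact: measurableT.
by apply/seteqP; split=> z //= _ p; case: (np p).
Qed.

Lemma measurable_W {d'} {Z : measurableType d'} (f g : Z -> X) :
  measurable_fun setT f -> measurable_fun setT g ->
  measurable_fun setT (fun z => W (f z) (g z)).
Proof.
move=> mf mg; have mfg := measurable_fun_pair mf mg.
exact: (measurableT_comp mW mfg).
Qed.

Lemma measurable_realizes_in {d'} {Z : measurableType d'} A F (e : F -> nat) m
    (f : Z -> seq X) :
  measurable A -> (forall z, size (f z) = m) -> (forall u, (e u < m)%N) ->
  (forall i, (i < m)%N -> measurable_fun setT (fun z => nth x0 (f z) i)) ->
  measurable [set z | realizes_in A e (f z)].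
Proof.
move=> mA sf em mf; apply: measurableI.
  apply: measurable_forall => u; apply: measurable_forall => v.
  apply: measurable_imply => _.
  have mw : measurable_fun setT (fun z => W (nth x0 (f z) (e u)) (nth x0 (f z) (e v))).
    by apply: measurable_W; apply: mf.
  set w := fun z => _ in mw; case: (edge u v).
    rewrite (_ : (fun z => _) = setT `&` w @^-1` `]0, +oo[%classic); first exact: mw.
    by rewrite setTI; apply/seteqP; split=> z; rewrite /preimage /= in_itv /= andbT.
  rewrite (_ : (fun z => _) = setT `&` w @^-1` `]-oo, 1[%classic); first exact: mw.
  by rewrite setTI; apply/seteqP; split=> z; rewrite /preimage /= in_itv.
rewrite (_ : (fun z => _) = [set z | forall i : 'I_m, A (nth x0 (f z) i)]).
  by apply: measurable_forall => i; apply: (measurable_preimage (mf i _)).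
apply/seteqP; split=> z /= h; first by move=> i; apply: h; rewrite mem_nth ?sf.
move=> x /(nthP x0)[i]; rewrite sf => ltim <-; exact: (h (Ordinal ltim)).
Qed.

(** Contraposition of [null_map]: a null set of copies of [F] would pull back, along the positions
    [fs], to a null set containing [P]. *)
Lemma positive_in_reindex mu A F n (fs : seq nat) (P : seq X -> Prop) :
  measurable A ->
  size fs = gorder F -> uniq fs -> {in fs, forall i, (i < n)%N} ->
  (forall s, size s = n -> P s -> realizes (fun u : F => nth 0%N fs u) s /\
     {in s, forall x, A x}) ->
  ~ null mu n P -> positive_in mu A F.
Proof.
move=> mA sfs ufs hfs hP; apply: contra_not => h.
have mS : measurable [set t : (gorder F).-tuple X |
    realizes_in A (@nat_of_ord _ : F -> nat) t].
  apply: (@measurable_realizes_in _ _ _ _ _ (gorder F)) => //.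
    by move=> t; rewrite size_tuple.
  by move=> i hi; apply: measurable_nth.
apply: null_sub (null_map x0 sfs ufs hfs mS h) => s sn /(hP s sn)[h1 h2]; split.
  by move=> u v /h1; rewrite !(nth_map 0%N) ?sfs ?ltn_ord.
by move=> x /mapP[i /hfs ltin ->]; apply: h2; rewrite mem_nth ?sn.
Qed.

Lemma positive_in_embeds mu A F G : measurable A ->
  embeds F G -> positive_in mu A G -> positive_in mu A F.
Proof.
move=> mA [f [injf ef]].
have sF : size (enum F) = gorder F by rewrite -cardE card_ord.
apply: (@positive_in_reindex _ _ _ _ [seq (f u : nat) | u <- enum F]) => //.
- by rewrite size_map.
- by rewrite map_inj_uniq ?enum_uniq// => u v /val_inj/injf.
- by move=> _ /mapP[u _ ->].
move=> s sn [h1 h2]; split=> // u v uv.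
have nthE (w : F) : nth 0%N [seq (f u : nat) | u <- enum F] w = f w.
  by rewrite (nth_map w) ?sF// nth_ord_enum.
by rewrite !nthE -ef; apply: h1; rewrite (inj_eq injf).
Qed.

Lemma positive_in_sub mu A B F : A `<=` B -> positive_in mu A F -> positive_in mu B F.
Proof.
move=> AB; apply: contra_not; apply: null_sub => s _ [h1 h2].
by split=> // x xs; apply: AB; exact: h2.
Qed.

End Patterns.

(** * Positivity of substitutions *)

Section Substitution.
Context {R : realType} {d : measure_display} {X : measurableType d}.
Variables (x0 : X) (W : X -> X -> R).
Implicit Types (mu : probability X R) (A : set X) (F : graph).
Hypothesis mW : measurable_fun setT (fun p : X * X => W p.1 p.2).

(** Here [fs] lists all positions and inverts [e], so [null_map] also works in the other direction:
    the vertices may be quantified in any order. *)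
Lemma positive_in_order mu A F n (e : F -> nat) (fs : seq nat) :
  measurable A -> gorder F = n -> size fs = n -> uniq fs ->
  {in fs, forall i, (i < n)%N} -> (forall u, (e u < n)%N) ->
  (forall u, nth 0%N fs (e u) = u) ->
  positive_in x0 W mu A F -> ~ null mu n (realizes_in x0 W A e).
Proof.
move=> mA Fn; case: n / Fn => sfs ufs hfs he hn; apply: contra_not => h.
have mS : measurable [set t : (gorder F).-tuple X | realizes_in x0 W A e t].
  apply: (@measurable_realizes_in _ _ _ _ _ mW _ _ _ _ _ (gorder F)) => //.
    by move=> t; rewrite size_tuple.
  by move=> i hi; apply: measurable_nth.
apply: null_sub (null_map x0 sfs ufs hfs mS h) => s sn [h1 h2]; split.
  by move=> u v /h1; rewrite !(nth_map 0%N) ?sfs ?he// !hn.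
by move=> x /mapP[i /hfs ltin ->]; apply: h2; rewrite mem_nth ?sn.
Qed.

(* Fixing the vertices of [F1] other than [v], the points that can play the
   role of [v] form a positive set, which contains copies of [F2]. *)
Lemma positive_in_subst mu A F1 (v : F1) F2 : measurable A ->
  positive_in x0 W mu A F1 ->
  (forall B, measurable B -> B `<=` A -> ~ mu.-negligible B ->
     positive_in x0 W mu B F2) ->
  positive_in x0 W mu A (subst v F2).
Proof.
move=> mA h1 h2.
have [n Fn] : exists n, gorder F1 = n.+1.
  by exists (gorder F1).-1; rewrite prednK//; apply: leq_ltn_trans (ltn_ord v).
have ltvn : (v < n.+1)%N by rewrite -Fn ltn_ord.
(* [v] is put last and the other vertices keep their order; [fs1] is the inverse listing. *)
pose pos1 (u : F1) := if u == v then n else unbump v u.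
have unbump_lt (u : F1) : u != v -> (unbump v u < n)%N.
  move=> uv; have ltun : (u < n.+1)%N by rewrite -Fn ltn_ord.
  have {uv} : (u : nat) != v by [].
  rewrite /unbump; case: (ltngtP v u) => //= [vu|uv] _.
    by rewrite subn1; case: (u : nat) vu ltun.
  by rewrite subn0; exact: leq_trans uv ltvn.
pose fs1 := rcons [seq bump v k | k <- iota 0 n] (v : nat).
have sfs1 : size fs1 = n.+1 by rewrite size_rcons size_map size_iota.
have {h1}h1 : ~ null mu (n + 1) (realizes_in x0 W A pos1).
  rewrite addn1; apply: (@positive_in_order _ _ _ _ _ fs1) => //.
  - rewrite rcons_uniq map_inj_uniq ?iota_uniq ?andbT//; last exact: (can_inj (bumpK v)).
    by apply/mapP => -[k _ /eqP]; rewrite (negPf (neq_bump _ _)).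
  - move=> k; rewrite mem_rcons inE => /predU1P[->//|/mapP[i]].
    rewrite mem_iota /= add0n => ltin ->.
    rewrite /bump; case: (leqP v i) => _; first by rewrite add1n ltnS.
    by rewrite add0n; exact: leqW.
  - by move=> u; rewrite /pos1; case: eqVneq => // /unbump_lt/ltnW; rewrite ltnS.
  - move=> u; rewrite /pos1; case: eqVneq => [->|uv].
      by rewrite nth_rcons size_map size_iota ltnn eqxx.
    rewrite nth_rcons size_map size_iota unbump_lt//.
    rewrite (nth_map 0%N) ?size_iota ?unbump_lt// nth_iota ?unbump_lt// add0n.
    by rewrite unbumpK// inE.
pose m := gorder F2.
(* In a tuple [y ++ x], the vertices of [F1] other than [v] use [y] and those of [F2] use [x]. *)
pose pos (w : subst_vertex v F2) : nat :=
  match w with inl a => unbump v (val a) | inr b => (n + (b : nat))%N end.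
have pos_lt w : (pos w < n + m)%N.
  case: w => [a|b] /=; last by rewrite ltn_add2l; exact: (ltn_ord b).
  by apply: leq_trans (unbump_lt _ (valP a)) _; rewrite leq_addr.
have pos_inj : injective pos.
  move=> [a|b] [a'|b'] /= E.
  - congr inl; apply: val_inj; apply: val_inj => /=.
    have := congr1 (bump v) E; rewrite !unbumpK ?inE //; [exact: (valP a')|exact: (valP a)].
  - by have := unbump_lt _ (valP a); rewrite E ltnNge leq_addr.
  - by have := unbump_lt _ (valP a'); rewrite -E ltnNge leq_addr.
  - by congr inr; apply: val_inj; move/eqP: E; rewrite eqn_add2l => /eqP.
pose F := subst v F2.
have sF : size (enum F) = gorder F by rewrite -cardE card_ord.
pose fs := [seq pos (enum_val (u : 'I_#|subst_vertex v F2|)) | u <- enum F].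
have nthE (u : F) : nth 0%N fs u = pos (enum_val u).
  by rewrite (nth_map u) ?sF// nth_ord_enum.
apply: (@positive_in_reindex _ _ _ _ _ mW _ _ _ (n + m) fs
  (fun s => realizes_in x0 W A (fun u : F => pos (enum_val u)) s)) => //.
- by rewrite size_map.
- by rewrite map_inj_uniq ?enum_uniq// => a b /pos_inj/enum_val_inj.
- by move=> _ /mapP[u _ ->].
- move=> s sn [k1 k2]; split=> // a b ab; rewrite !nthE; exact: k1.
rewrite null_cat; move: h1; rewrite null_cat; apply: contra_not.
apply: null_sub => y yn h.
pose B := [set x | realizes_in x0 W A pos1 (rcons y x)].
have mB : measurable B.
  apply: (@measurable_realizes_in _ _ _ _ _ mW _ _ _ _ _ n.+1) => //.
  - by move=> z; rewrite size_rcons yn.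
  - by move=> u; rewrite /pos1; case: eqVneq => // /unbump_lt/ltnW; rewrite ltnS.
  move=> i hi; under eq_fun => z do rewrite nth_rcons yn.
  case: (ltngtP i n) => _; first exact: measurable_cst.
    exact: measurable_cst.
  exact: measurable_id.
have BA : B `<=` A by move=> x [_]; apply; rewrite mem_rcons inE eqxx.
have posB : ~ mu.-negligible B.
  move=> nB; apply: h => /=; apply: negligibleS nB => x /=.
  by rewrite cats1 => /contrapT.
(* A single candidate [z] for [v] certifies the relations among the points of [y] and their
   membership in [A], even when [F2] has no vertex. *)
have [z Bz] : exists z, B z.
  apply: contrapT => nz; apply: posB; rewrite (_ : B = set0); first exact: negligible_set0.
  by apply/seteqP; split=> // z Bz; apply: nz; exists z.
have := h2 B mB BA posB; apply: contra_not; apply: null_sub => x xn [r2 xB].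
have yA t : t \in y -> A t.
  by move=> ty; apply: Bz.2; rewrite mem_rcons inE ty orbT.
split; last first.
  by move=> t; rewrite mem_cat => /orP[/yA//|/xB/BA].
have nthl a : nth x0 (y ++ x) (pos (inl a)) = nth x0 y (pos (inl a)).
  by rewrite nth_cat yn (unbump_lt _ (valP a)).
have nthr b : nth x0 (y ++ x) (pos (inr b)) = nth x0 x b.
  by rewrite nth_cat yn /= ltnNge leq_addr /= addKn.
have nth1 (a : {a : F1 | a != v}) t : nth x0 (rcons y t) (pos1 (val a)) = nth x0 y (pos (inl a)).
  by rewrite /pos1 (negPf (valP a)) nth_rcons yn unbump_lt//; exact: (valP a).
have nth2 t : nth x0 (rcons y t) (pos1 v) = t.
  by rewrite /pos1 eqxx nth_rcons yn ltnn eqxx.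
have xB' (b : F2) : B (nth x0 x b) by apply: xB; rewrite mem_nth ?xn.
move=> i j ij /=; rewrite /subst_edge_ord.
have : enum_val i != enum_val j by rewrite (inj_eq enum_val_inj).
case: (enum_val i) (enum_val j) => [a|b] [a'|b'] hab.
- rewrite !nthl /=; have [+ _] := Bz.
  by move=> /(_ (val a) (val a') hab) /=; rewrite !nth1.
- rewrite nthl nthr /=; have [+ _] := xB' b'.
  by move=> /(_ (val a) v (valP a)) /=; rewrite nth1 nth2.
- rewrite nthl nthr /=; have [+ _] := xB' b.
  by move=> /(_ v (val a')) /=; rewrite eq_sym (valP a') nth1 nth2; apply.
- by rewrite !nthr /=; exact: (r2 b b' hab).
Qed.

End Substitution.

(** * Subgraphons and positive sets *)

Section Supports.
Context {R : realType} {d : measure_display} {X : measurableType d}.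
Implicit Types (mu nu : probability X R) (A : set X) (F : graph).

(** Mutual absolute continuity of [nu] and the restriction of [mu] to [A]: all that the argument
    keeps of the density defining a subgraphon. *)
Definition concentrated nu mu A : Prop :=
  forall N, nu.-negligible N <-> mu.-negligible (N `&` A).

Lemma concentratedT mu : concentrated mu mu setT.
Proof. by move=> N; rewrite setIT. Qed.

Lemma concentrated_trans nu2 nu1 mu A1 A2 :
  concentrated nu2 nu1 A2 -> concentrated nu1 mu A1 ->
  concentrated nu2 mu (A2 `&` A1).
Proof. by move=> h2 h1 N; rewrite h2 h1 setIA. Qed.

(** A null cover of the part of [N] in [A] becomes a cover of [N] by adding the complement of [A],
    which [nu] does not charge. *)
Lemma concentrated_intro nu mu A : measurable A ->
  (forall B, measurable B -> nu B = 0%E <-> mu (B `&` A) = 0%E) ->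
  concentrated nu mu A.
Proof.
move=> mA h N; split=> -[B [mB B0 NB]].
  exists (B `&` A); split; [exact: measurableI|exact/h|exact: setSI].
have mBA : measurable (B `|` ~` A) by apply: measurableU => //; exact: measurableC.
exists (B `|` ~` A); split=> //.
  apply/h => //; rewrite setIUl setICl setU0.
  by apply: (subset_measure0 _ mB _ B0) => //; exact: measurableI.
by move=> x Nx; have [Ax|] := pselect (A x); [left; apply: NB|right].
Qed.

Lemma concentrated_not_negligible nu mu A : concentrated nu mu A ->
  ~ mu.-negligible A.
Proof.
move=> h h0; have : nu setT = 0%E.
  by apply: measure_negligible => //; apply/h; rewrite setTI.
by move/eqP; rewrite probability_setT onee_eq0.
Qed.

Lemma probability_inhabited mu : X.
Proof.
suff /cid[x _] : exists x : X, True by exact: x.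
apply: contrapT => h; have := @probability_setT _ _ _ mu.
rewrite (_ : setT = set0) ?measure0; last by apply/seteqP; split=> // x; case: h; exists x.
by move/eqP; rewrite eq_sym onee_eq0.
Qed.

(** The integrand is nonzero exactly on the tuples that realize [F], so the density is positive when
    these are not null for [gmeas W']; [null_restrict] then passes to [mu] on [A]. *)
Lemma Q_concentrated (x0 : X) (W W' : graphon R X) mu A F :
  (forall x y, W' x y = W x y) -> concentrated (gmeas W') mu A ->
  Q W' F <-> positive_in x0 W mu A F.
Proof.
move=> eW hA; rewrite /Q /= /graphon_density.
(* The other pairs get the factor 1, so that the product runs over all pairs. *)
pose fac (s : seq X) (p : 'I_(gorder F) * 'I_(gorder F)) : R :=
  if (p.1 < p.2)%N then
    if edge p.1 p.2 then W (nth x0 s p.1) (nth x0 s p.2)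
    else 1 - W (nth x0 s p.1) (nth x0 s p.2)
  else 1.
pose h s : \bar R := (\prod_p fac s p)%:E.
have fac0 s p : 0 <= fac s p.
  rewrite /fac; case: ifP => // _.
  have /andP[w0 w1] := graphon_itv W (nth x0 s p.1) (nth x0 s p.2).
  by case: ifP; rewrite ?subr_ge0.
have h0 s : (0 <= h s)%E by rewrite lee_fin; apply: prodr_ge0.
have mh : measurable_fun setT (fun t : (gorder F).-tuple X => h t).
  apply/measurable_EFinP; apply: measurable_prod => p _.
  rewrite /fac /=; case: (p.1 < p.2)%N; last exact: measurable_cst.
  have mw : measurable_fun setT (fun t : (gorder F).-tuple X =>
      W (nth x0 t p.1) (nth x0 t p.2)).
    by apply: (measurable_W (graphon_measurable W)); exact: measurable_nth.
  case: (edge p.1 p.2) => //; apply: measurable_funB => //; exact: measurable_cst.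
rewrite (_ : integral_tuple _ _ =
    integral_tuple (gmeas W') (fun t : (gorder F).-tuple X => h t)); last first.
  congr integral_tuple; apply/funext => t; rewrite /h big_mkcond /=.
  congr EFin; apply: eq_bigr => p _; rewrite /fac.
  by rewrite !eW !(tnth_nth x0).
rewrite lt_def integral_tuple_ge0// andbT.
rewrite /positive_in (_ : null mu _ _ <->
  null (gmeas W') (gorder F) (fun s => h s != 0%E)).
  rewrite -(integral_tuple_eq0 (gmeas W') h0 mh).
  by split; [move/eqP|move/eqP].
rewrite (null_restrict _ _ hA).
have E s : realizes x0 W (@nat_of_ord _ : F -> nat) s <-> h s != 0%E.
  rewrite /h eqe; split=> [r|/prodf_neq0 r u v].
    apply/prodf_neq0 => -[u v] _ /=; rewrite /fac /=; case: ltnP => [uv|]; last by rewrite oner_eq0.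
    have := r u v; rewrite -val_eqE /= ltn_eqF// => /(_ isT).
    by case: edge => [/lt0r_neq0//|]; rewrite -subr_gt0 => /lt0r_neq0.
  have {}r (a b : F) : (a < b)%N -> let w := W (nth x0 s a) (nth x0 s b) in
      if edge a b then 0 < w else w < 1.
    move=> ab; have := r (a, b) isT; rewrite /fac /= ab.
    have /andP[w0 w1] := graphon_itv W (nth x0 s a) (nth x0 s b).
    by case: edge; rewrite ?subr_eq0 => wn; rewrite lt_def ?wn// eq_sym.
  (* The integrand tests only increasing pairs; symmetry gives the others. *)
  rewrite -val_eqE neq_ltn => /orP[]; first exact: r.
  by move=> /r /=; rewrite edge_sym graphon_sym.
by split; apply: null_sub => s _ [] /E hs hA'.
Qed.

(** [A] is the set where [f] is positive: the integral of [f] over [B] vanishes exactly when [B]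
    meets it in a null set. *)
Lemma subgraphon_support (W W' : graphon R X) : is_subgraphon W' W ->
  exists2 A, measurable A & concentrated (gmeas W') (gmeas W) A.
Proof.
move=> [_ [f [mf f01 f_gt0 hf]]]; set mu := gmeas W in f_gt0 hf *.
have mA : measurable [set x | 0 < f x].
  rewrite (_ : mkset _ = setT `&` f @^-1` `]0, +oo[%classic); first exact: mf.
  by rewrite setTI; apply/seteqP; split=> z; rewrite /preimage /= in_itv /= andbT.
exists [set x | 0 < f x] => //.
apply: concentrated_intro => // B mB; rewrite hf//.
have mfB : measurable_fun B (EFin \o f).
  by apply: measurable_funTS; exact/measurable_EFinP.
have f0 x : 0 <= f x by have /andP[] := f01 x.
have fin : (\int[mu]_(x in B) (f x)%:E)%E \is a fin_num.
  rewrite ge0_fin_numE ?integral_ge0// => [|x _]; last by rewrite lee_fin.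
  apply: (@le_lt_trans _ _ (\int[mu]_(x in B) (cst 1%E x))%E).
    apply: ge0_le_integral => //; first by move=> x _; rewrite lee_fin.
    by move=> x _; rewrite lee_fin; have /andP[] := f01 x.
  rewrite integral_cst// mul1e; apply: le_lt_trans (probability_le1 mu mB) _.
  exact: ltry.
have -> : ((\int[mu]_(x in B) f x / \int[mu]_x f x)%:E = 0%E) <->
    (\int[mu]_(x in B) (f x)%:E = 0)%E.
  rewrite -[X in _ <-> X = _](fineK fin) -/(Rintegral mu B f).
  split=> [[] /eqP|[->]]; last by rewrite mul0r.
  by rewrite mulf_eq0 invr_eq0 (gt_eqF f_gt0) orbF => /eqP ->.
rewrite (_ : (\int[mu]_(x in B) (f x)%:E = \int[mu]_(x in B) `|(EFin \o f) x|)%E); last first.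
  by apply: eq_integral => x _; rewrite gee0_abs// lee_fin.
rewrite ae_eq_integral_abs//; split=> h.
  apply: measure_negligible; first exact: measurableI.
  apply: negligibleS h => x /= [Bx fx] /(_ Bx)[] fx0.
  by rewrite fx0 ltxx in fx.
exists (B `&` [set x | 0 < f x]); split=> //; first exact: measurableI.
move=> x /= /not_implyP[Bx fx]; split=> //.
by rewrite lt_def f0 andbT; apply/eqP => fx0; apply: fx; rewrite fx0.
Qed.

(** The measure is [mu] conditioned on [A], obtained from the indicator of [A] as density. *)
Lemma restriction_exists (W : graphon R X) A : measurable A ->
  ~ (gmeas W).-negligible A ->
  exists W' : graphon R X,
    is_subgraphon W' W /\ concentrated (gmeas W') (gmeas W) A.
Proof.
move=> mA nA; set mu := gmeas W.
have muA0 : mu A != 0%E by apply/eqP => /(negligibleP _ mA).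
have muAf : mu A \is a fin_num by exact: fin_num_measure.
have [c cE] : exists c, mu A = c%:E by exists (fine (mu A)); rewrite fineK.
have c_gt0 : 0 < c by rewrite -lte_fin -cE lt_def muA0 measure_ge0.
pose nu : probability X R := mnormalize (mrestr mu mA) mu.
have nuE B : nu B = (mu (B `&` A) * c^-1%:E)%E.
  have mT : mrestr mu mA setT = c%:E by rewrite /mrestr setTI.
  rewrite /nu /= /mnormalize; case: ifPn => [h|_].
    (* The default branch of [mnormalize], for total mass 0 or infinity, is excluded. *)
    suff : (c%:E == 0%E) || (c%:E == +oo%E) by rewrite eqe (gt_eqF c_gt0).
    by rewrite -mT; exact: h.
  by congr (_ * (_^-1)%:E)%E; exact: (congr1 fine mT).
have nuA : atomless nu.
  move=> B mB; rewrite nuE => nuB.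
  have mBA : measurable (B `&` A) by exact: measurableI.
  have cV : (0 < c^-1%:E)%E by rewrite lte_fin invr_gt0.
  have BA0 : (0 < mu (B `&` A))%E by rewrite pmule_lgt0 in nuB.
  have [C [mC CB C0 CBA]] := graphon_atomless mBA BA0.
  have CA : C `&` A = C by apply/setIidPl => x /CB[].
  exists C; split=> //; first by move=> x /CB[].
  - by rewrite nuE CA mule_gt0.
  - by rewrite !nuE CA lte_pmul2r.
have intA : \int[gmeas W]_x (\1_A x : R) = c.
  by rewrite /Rintegral integral_indic// setIT; exact: (congr1 fine cE).
exists (Graphon (graphon_standard W) nuA (graphon_sym W) (graphon_measurable W)
  (graphon_itv W)); split.
  split=> //; exists (\1_A); split.
  - exact: measurable_indic.
  - by move=> x; rewrite indicE; case: (x \in A); rewrite ?lexx ler01.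
  - by rewrite intA.
  - move=> B mB; rewrite /= nuE intA /Rintegral integral_indic//.
    by rewrite EFinM fineK ?fin_num_measure// 1?setIC//; exact: measurableI.
apply: concentrated_intro => // B mB /=; rewrite nuE; split=> [/eqP|->]; last by rewrite mul0e.
rewrite mule_eq0 => /orP[/eqP//|].
by rewrite eqe invr_eq0 gt_eqF.
Qed.

End Supports.

(** * Almost finite primes give weak randomness *)

Lemma embeds_trans F G H : embeds F G -> embeds G H -> embeds F H.
Proof.
move=> [f [injf ef]] [g [injg eg]]; exists (g \o f); split; first exact: inj_comp.
by move=> u v /=; rewrite eg ef.
Qed.

Lemma embeds_leq F G : embeds F G -> (gorder F <= gorder G)%N.
Proof. by move=> [f [injf _]]; have := leq_card f injf; rewrite !card_ord. Qed.

Lemma embeds_iso F G : embeds F G -> (gorder G <= gorder F)%N -> iso F G.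
Proof.
move=> [f [injf ef]] GF; exists f; split=> //.
by apply: inj_card_bij => //; rewrite !card_ord.
Qed.

Lemma iso_embeds F G : iso F G -> embeds F G.
Proof. by move=> [f [bf ef]]; exists f; split=> //; exact: bij_inj. Qed.

Lemma iso_sym F G : iso F G -> iso G F.
Proof.
move=> [f [[g fK gK] ef]]; exists g; split; first by exists f.
by move=> u v; rewrite -ef !gK.
Qed.

Lemma gorder_subst (F1 : graph) (v : F1) (F2 : graph) :
  gorder (subst v F2) = ((gorder F1).-1 + gorder F2)%N.
Proof.
rewrite /= /subst_vertex card_sum card_sig card_ord; congr addn.
rewrite (eq_card (B := predC1 v)) ?cardC1 ?card_ord//.
Qed.

(** Embeddings can thus be built on the sum type, without the numbering of the vertices of
    [subst]. *)
Lemma embeds_subst (F1 : graph) (v : F1) (F2 : graph) (G : graph)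
    (f : G -> subst_vertex v F2) :
  injective f -> (forall x y, subst_edge (f x) (f y) = edge x y) ->
  embeds G (subst v F2).
Proof.
move=> injf ef; exists (fun x => enum_rank (f x)); split.
  by move=> x y /enum_rank_inj/injf.
by move=> x y; rewrite /= /subst_edge_ord !enum_rankK.
Qed.

Lemma embeds_subst_r (F1 : graph) (v : F1) (F2 : graph) : embeds F2 (subst v F2).
Proof. by apply: (@embeds_subst _ _ _ _ inr) => // x y []. Qed.

Lemma embeds_subst_l (F1 : graph) (v : F1) (F2 : graph) :
  (0 < gorder F2)%N -> embeds F1 (subst v F2).
Proof.
move=> F2_gt0; pose b : F2 := Ordinal F2_gt0.
pose f (x : F1) : subst_vertex v F2 := if insub x is Some y then inl y else inr b.
apply: (@embeds_subst _ _ _ _ f) => x y; rewrite /f.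
  case: insubP => [x' _ <-|/negPn/eqP ->]; case: insubP => [y' _ <-|/negPn/eqP ->] //.
  by case=> ->.
case: insubP => [x' _ <-|/negPn/eqP ->]; case: insubP => [y' _ <-|/negPn/eqP ->] //=.
by rewrite !edge_irr.
Qed.

(** A sequence with no such pair has a subsequence of nondecreasing orders. There, a later graph
    embedded in an earlier one would be isomorphic to it, so the subsequence is an antichain. *)
Lemma almost_finite_good (A : set graph) (G : nat -> graph) :
  almost_finite A -> (forall n, A (G n)) ->
  exists i j, (i < j)%N /\ embeds (G i) (G j).
Proof.
move=> fA AG; apply: contrapT => bad; apply: fA.
have {}bad i j : (i < j)%N -> ~ embeds (G i) (G j).
  by move=> ij e; apply: bad; exists i, j.
have /choice[m mP] : forall N, exists m, (N <= m)%N /\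
    forall j, (N <= j)%N -> (gorder (G m) <= gorder (G j))%N.
  move=> N; pose P k := `[< exists2 j, (N <= j)%N & gorder (G j) = k >].
  have exP : exists k, P k by exists (gorder (G N)); apply/asboolP; exists N.
  case: (ex_minnP exP) => k /asboolP[m Nm mk] kmin; exists m; split=> // j Nj.
  by rewrite mk; apply: kmin; apply/asboolP; exists j.
pose k := fix k n := if n is n'.+1 then m (k n').+1 else m 0%N.
have kS n : (k n < k n.+1)%N by have [] := mP (k n).+1.
have klt i j : (i < j)%N -> (k i < k j)%N by apply: (homo_ltn ltn_trans kS).
have kmin i j : (i < j)%N -> (gorder (G (k i)) <= gorder (G (k j)))%N.
  move=> ij; have := klt i j ij; case: i ij => [|i] ij kij /=.
    by have [_] := mP 0%N; apply.
  by have [_] := mP (k i).+1; apply; apply: ltn_trans (kS i) kij.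
exists (G \o k); split=> [n|i j ij] /=; first exact: AG.
have /orP[lij|lji] : (i < j)%N || (j < i)%N by rewrite -neq_ltn; apply/eqP.
  exact: bad (klt _ _ lij).
move=> e; apply: (bad _ _ (klt _ _ lji)); apply/iso_embeds/iso_sym.
exact: embeds_iso e (kmin _ _ lji).
Qed.

Section Backward.
Context {R : realType}.

Lemma graph_density_eq0 F G : ~ embeds F G -> graph_density F G = 0 :> R.
Proof.
move=> nFG; rewrite /graph_density eq_card0 ?mul0r// => f.
apply/negP; rewrite in_setE /= => /andP[/injectiveP injf /'forall_forallP ef].
by apply: nFG; exists f; split=> // u v; apply/eqP; exact: ef.
Qed.

(** A graph that is not a model embeds in no [G n], so its densities and their limit are 0. *)
Lemma Q_models {d} {X : measurableType d} (T : universal_theory)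
    (W : graphon R X) F : is_graphon_of T W -> Q W F -> models T F.
Proof.
move=> [G [TG cG]] WF; apply: contrapT => nF.
have := cG F; rewrite (_ : (fun n => _) = cst 0%E); last first.
  apply/funext => n; rewrite graph_density_eq0// => e.
  exact: nF (models_hereditary e (TG n)).
move=> /(cvg_unique (@ereal_hausdorff R) (cvg_cst 0%E)) D0.
by move: WF; rewrite /Q /= -D0 ltxx.
Qed.

Lemma primally_almost_finite_weakly_random (T : universal_theory) :
  primally_almost_finite (models T) -> weakly_random_erdos_hajnal R T.
Proof.
move=> fT d X W TW; set mu := gmeas W.
have x0 := probability_inhabited mu.
have mW := graphon_measurable W.
pose D A F := positive_in x0 W mu A F.
pose ok A := measurable A /\ ~ mu.-negligible A.
have okT : ok setT.
  split=> // /(measure_negligible measurableT)/eqP.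
  by rewrite [X in X == _]probability_setT onee_eq0.
have DT F A : D A F -> models T F.
  move=> /(positive_in_sub (@subsetT _ A)) DF; apply: (Q_models TW).
  exact/(@Q_concentrated _ _ _ x0 W W mu setT)/DF/concentratedT.
have [A [mA nA] Amin] : exists2 A, ok A & forall B, ok B -> B `<=` A ->
    forall F, prime_graph F -> D A F -> D B F.
  apply: contrapT => nex.
  (* Otherwise every positive set has a positive subset in which some prime stops being positive. *)
  have /choice[g gP] : forall A : {A : set X | ok A}, exists BF : {B : set X | ok B} * graph,
      [/\ sval BF.1 `<=` sval A, prime_graph BF.2, D (sval A) BF.2 &
          ~ D (sval BF.1) BF.2].
    move=> [A okA]; apply: contrapT => h; apply: nex; exists A => // B okB BA F pF DF.
    apply: contrapT => nDF; apply: h; exists (exist _ B okB, F); split=> //.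
  pose A n := iter n (fun A => (g A).1) (exist _ setT okT).
  pose G n := (g (A n)).2.
  have Adec i j : (i <= j)%N -> sval (A j) `<=` sval (A i).
    move=> /subnK <-; elim: (j - i)%N => // k IH; apply: subset_trans IH.
    by rewrite addSn /=; have [] := gP (A (k + i)%N).
  have [|i [j [ij e]]] := almost_finite_good (G := G) fT.
    by move=> n; have [_ pG DG _] := gP (A n); split=> //; exact: DT DG.
  (* [G j] is positive in [A j], hence in the larger [A i.+1], and so is [G i], which was lost
     there. *)
  have [_ _ _] := gP (A i); apply.
  have [_ _ DGj _] := gP (A j).
  have mB : measurable (sval (A i.+1)) by exact: (svalP (A i.+1)).1.
  apply: (positive_in_embeds mW mB e).
  exact: positive_in_sub (Adec _ _ ij) DGj.
have Dsub n F B : (gorder F < n)%N -> ok B -> B `<=` A -> D A F -> D B F.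
  elim: n F B => // n IH F B Fn okB BA DF.
  have [pF|/contrapT[F1 [v [F2 [F1F F2F isoF]]]]] := pselect (prime_graph F).
    exact: Amin DF.
  (* With [F2] empty the substitution only deletes [v], and [F] would be smaller than [F1].
     Nonemptiness makes [F1] embed in [F]. *)
  have F2_gt0 : (0 < gorder F2)%N.
    rewrite lt0n; apply/eqP => F20; have := embeds_leq (iso_embeds isoF).
    rewrite gorder_subst F20 addn0 => FF1.
    by have := leq_trans F1F (leq_trans FF1 (leq_pred _)); rewrite ltnn.
  have eF := iso_embeds (iso_sym isoF).
  have small G : (gorder G < gorder F)%N -> (gorder G < n)%N.
    by move=> /leq_trans; apply.
  apply: (positive_in_embeds mW okB.1 (iso_embeds isoF)).
  apply: (positive_in_subst mW okB.1) => [|C mC CB nC].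
    apply: IH => //; first exact: small.
    exact: (positive_in_embeds mW mA (embeds_trans (embeds_subst_l v F2_gt0) eF)).
  apply: IH => //; first exact: small.
    exact: subset_trans CB BA.
  exact: (positive_in_embeds mW mA (embeds_trans (embeds_subst_r v F2) eF)).
(* A subgraphon [W''] of [W'] lives on a positive subset of [A], to which [Dsub] applies. *)
have [W' [sW' cW']] := restriction_exists mA nA; exists W'; split=> // W'' sW''.
have [B mB cW''] := subgraphon_support sW''.
have cW := concentrated_trans cW'' cW'.
have eW'' x y : W'' x y = W x y by rewrite sW''.1 sW'.1.
apply/seteqP; split=> F.
  move/(Q_concentrated x0 F eW'' cW) => h.
  apply/(Q_concentrated x0 F sW'.1 cW'); exact: positive_in_sub h.
move/(Q_concentrated x0 F sW'.1 cW') => h.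
apply/(Q_concentrated x0 F eW'' cW); apply: (Dsub (gorder F).+1) => //.
split; first exact: measurableI.
exact: concentrated_not_negligible cW.
Qed.

End Backward.

(** * Modules and lexicographic products *)

Section InducedGraph.
Variables (F : graph) (P : pred F).

Definition induced_edge : rel 'I_#|{: {x : F | P x}}| :=
  fun i j => edge (val (enum_val i)) (val (enum_val j)).

Lemma induced_sym : symmetric induced_edge.
Proof. by move=> i j; rewrite /induced_edge edge_sym. Qed.

Lemma induced_irr : irreflexive induced_edge.
Proof. by move=> i; rewrite /induced_edge edge_irr. Qed.

Definition induced : graph := Graph induced_sym induced_irr.

Definition induced_val (i : induced) : F :=
  val (enum_val (i : 'I_#|{: {x : F | P x}}|)).

Lemma induced_valP i : P (induced_val i).
Proof. exact: valP. Qed.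

Lemma induced_val_inj : injective induced_val.
Proof. by move=> i j /val_inj/enum_val_inj. Qed.

Lemma induced_val_onto x : P x -> exists i, induced_val i = x.
Proof.
move=> Px; exists (enum_rank (exist _ x Px : {x | P x})).
by rewrite /induced_val enum_rankK.
Qed.

Lemma gorder_induced : gorder induced = #|P|.
Proof. by rewrite /= card_sig. Qed.

End InducedGraph.

(* The fibre of [phi] over a repeated value is a module of [F]. *)
Lemma prime_fiber (F : graph) (phi : F -> nat) (r : rel nat) :
  prime_graph F ->
  (forall u v, phi u != phi v -> edge u v = r (phi u) (phi v)) ->
  injective phi \/ forall u v, phi u = phi v.
Proof.
move=> pF hphi; apply: contrapT => /not_orP[ninj ncst].
have [u0 [v0 [uv0 euv0]]] : exists u0 v0, phi u0 = phi v0 /\ u0 != v0.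
  apply: contrapT => h; apply: ninj => u v euv; apply/eqP; apply: contrapT => /negP nuv.
  by apply: h; exists u, v.
have [w0 hw0] : exists w0, phi w0 != phi u0.
  apply: contrapT => h; apply: ncst => u v.
  have E w : phi w = phi u0.
    by apply/eqP; apply: contrapT => /negP hw; apply: h; exists w.
  by rewrite !E.
(* Collapsing the fibre [M] to [u0] leaves [N]; substituting [M] back for [u0] recovers [F]. *)
pose M : pred F := [pred x | phi x == phi u0].
pose N : pred F := [pred x | (phi x != phi u0) || (x == u0)].
have [v vE] : exists v : induced N, induced_val v = u0.
  by apply: induced_val_onto; rewrite /N /= !eqxx.
have cF : (#|predC M| + #|M| = gorder F)%N by rewrite addnC cardC card_ord.
have cN : #|N| = #|predC M|.+1.
  rewrite (cardD1 u0) inE /= !eqxx /= add1n; congr _.+1; apply: eq_card => x.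
  rewrite !inE /= /M /=; have [->|_] := eqVneq x u0; first by rewrite eqxx.
  by rewrite orbF.
(* [u0] and [v0] lie in [M] and [w0] outside, so both factors are smaller than [F]. *)
have M2 : (1 < #|M|)%N.
  rewrite (cardD1 u0) inE /= eqxx (cardD1 v0) !inE /= -uv0 eqxx andbT.
  by rewrite eq_sym euv0.
have M1 : (0 < #|predC M|)%N by apply/card_gt0P; exists w0; rewrite !inE.
apply: pF; exists (induced N), v, (induced M); split.
- by rewrite gorder_induced cN -cF -addn1 ltn_add2l.
- by rewrite gorder_induced -cF -[X in (X < _)%N]add0n ltn_add2r.
have /choice[f fP] : forall x : F, exists w : subst_vertex v (induced M),
    match w with
    | inl a => phi x != phi u0 /\ induced_val (val a) = x
    | inr b => phi x = phi u0 /\ induced_val b = x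
    end.
  move=> x; have [xM|xM] := eqVneq (phi x) (phi u0).
    have [b bx] : exists b : induced M, induced_val b = x.
      by apply: induced_val_onto; rewrite /M /= xM.
    by exists (inr b).
  have [a ax] : exists a : induced N, induced_val a = x.
    by apply: induced_val_onto; rewrite /N /= xM.
  have av : a != v by apply: contraNneq xM => av; rewrite -ax av vE.
  by exists (inl (exist _ a av)).
apply: embeds_iso; last by rewrite gorder_subst !gorder_induced cN /= cF.
apply: (@embeds_subst _ _ _ _ f).
  move=> x y fxy; have := fP x; have := fP y; rewrite fxy.
  by case: (f y) => [a|b] [_ <-] [_ <-].
move=> x y; have := fP x; have := fP y.
case: (f x) => [a|b]; case: (f y) => [a'|b'] [hy ey] [hx ex] /=.
- exact: (congr2 (fun x y => edge x y) ex ey).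
- transitivity (edge x u0); first exact: (congr2 (fun x y => edge x y) ex vE).
  by rewrite !hphi ?hy.
- transitivity (edge u0 y); first exact: (congr2 (fun x y => edge x y) vE ey).
  by rewrite !hphi ?hx// eq_sym.
- exact: (congr2 (fun x y => edge x y) ex ey).
Qed.

(** Without edges, [prime_fiber] applies to any function; one that separates a vertex from two
    others is neither injective nor constant. *)
Lemma prime_edgeless (F : graph) : prime_graph F ->
  (forall u v : F, edge u v = false) -> (gorder F <= 2)%N.
Proof.
move=> pF hF; rewrite leqNgt; apply/negP => F3.
pose i (k : nat) (h : (k < 3)%N) : F := Ordinal (leq_trans h F3).
have [inj|cst] := @prime_fiber F (fun u => (u == i 0%N isT) : nat) (fun _ _ => false) pF
  (fun u v _ => hF u v).
  by have /(congr1 val) := inj (i 1%N isT) (i 2%N isT) erefl.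
by have := cst (i 0%N isT) (i 1%N isT).
Qed.

(** If [G i] has at most two vertices, all other members, to avoid it, are complete or all are
    edgeless; two of those are comparable by their orders. *)
Lemma antichain_order (G : nat -> graph) :
  (forall i j, i <> j -> ~ embeds (G i) (G j)) -> forall i, (2 < gorder (G i))%N.
Proof.
move=> anti i; rewrite ltnNge; apply/negP => Gi.
pose b := [exists u : G i, exists v : G i, edge u v].
have hom j : i <> j -> forall u v : G j, u != v -> edge u v = ~~ b.
  move=> ij u v uv; apply: contrapT => h; apply: (anti i j ij).
  have {h} eb : edge u v = b.
    by move: h; case: (edge u v); case: b.
  pose f (x : G i) : G j := if val x == 0%N then u else v.
  have injf : injective f.
    move=> x y; rewrite /f => fxy; apply: val_inj.
    have x2 : (val x < 2)%N := leq_trans (ltn_ord x) Gi.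
    have y2 : (val y < 2)%N := leq_trans (ltn_ord y) Gi.
    move: x2 y2 fxy uv.
    by case: (val x) => [|[|?]]; case: (val y) => [|[|?]] //= _ _ ->; rewrite eqxx.
  exists f; split=> // x y.
  have [->|xy] := eqVneq x y; first by rewrite !edge_irr.
  have two (p q : G i) : p != q -> edge p q = b.
    move=> pq; apply/idP/existsP => [e|[p' /existsP[q' e]]].
      by exists p; apply/existsP; exists q.
    have pq' : p' != q' by apply: contraTneq e => ->; rewrite edge_irr.
    have val_lt (z : G i) : (z < 2)%N by apply: leq_trans (ltn_ord z) Gi.
    have [[ep eq]|[ep eq]] : (p = p' /\ q = q') \/ (p = q' /\ q = p').
      move: (val_lt p) (val_lt q) (val_lt p') (val_lt q') pq pq'.
      rewrite -!val_eqE /=.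
      case Ep: (nat_of_ord p) => [|[|?]] //; case Eq: (nat_of_ord q) => [|[|?]] // _ _;
      case Ep': (nat_of_ord p') => [|[|?]] //; case Eq': (nat_of_ord q') => [|[|?]] // _ _ _ _;
      [left|right|right|left]; split; apply: val_inj => /=; congruence.
      by rewrite ep eq.
    by rewrite ep eq edge_sym.
  rewrite (two x y xy); have fxy : f x != f y by rewrite (inj_eq injf).
  move: fxy; rewrite /f; do 2!case: ifP => _ //; rewrite ?eqxx//.
  by rewrite edge_sym.
have emb j k : i <> j -> i <> k -> (gorder (G j) <= gorder (G k))%N -> embeds (G j) (G k).
  move=> ij ik jk; exists (widen_ord jk); split.
    by move=> x y /(congr1 val) /= e; apply: val_inj.
  move=> u v; have [->|uv] := eqVneq u v; first by rewrite !edge_irr.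
  by rewrite (hom j)// (hom k).
have n1 : i <> i.+1 by move/eqP; rewrite ltn_eqF.
have n2 : i <> i.+2 by move/eqP; rewrite ltn_eqF// ltnW.
have n3 : i.+1 <> i.+2 by move/eqP; rewrite ltn_eqF.
have /orP[h|h] := leq_total (gorder (G i.+1)) (gorder (G i.+2)).
  by apply: (anti _ _ n3); exact: emb.
by apply: (anti _ _ (nesym n3)); exact: emb.
Qed.

(** * Lexicographic products as iterated substitutions *)

Section Lexicographic.
Variable T : universal_theory.
Hypothesis hT : closed_under_substitution (models T).

(** Induction on a list of the vertices of [H] whose fibre may have several points: one fibre is
    collapsed to a point, for which [B] is then substituted. *)
Lemma lexicographic_models (G H B : graph) (p : G -> H) (q : G -> B) :
  (forall x y, p x = p y -> q x = q y -> x = y) ->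
  (forall x y, edge x y = if p x != p y then edge (p x) (p y) else edge (q x) (q y)) ->
  models T H -> models T B -> models T G.
Proof.
move=> inj eG TH TB.
(* The invariant says that fibres outside the list have at most one point; it is vacuous for the
   full list. *)
have : forall x y, p x \notin enum H -> p x = p y -> x = y.
  by move=> x y; rewrite mem_enum.
elim: (enum H) G p q inj eG => [|h S IH] G p q inj eG single.
  apply: (models_hereditary _ TH); exists p; split; first by move=> x y; exact: single.
  move=> x y; rewrite eG; case: eqVneq => //= pxy.
  by rewrite (single x y)// !edge_irr.
have [[u0 /eqP pu0]|nh] := pselect (exists u0, p u0 == h); last first.
  apply: (IH G p q) => // x y xS; apply: single; rewrite inE negb_or xS andbT.
  by apply/negP => px; apply: nh; exists x.
pose N : pred G := [pred x | (p x != h) || (x == u0)].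
have [v vE] : exists v : induced N, induced_val v = u0.
  by apply: induced_val_onto; rewrite /N /= eqxx orbT.
have TN : models T (induced N).
  apply: (IH _ (p \o @induced_val _ N) (q \o @induced_val _ N)).
  - by move=> x y /= px qx; apply: induced_val_inj; exact: inj.
  - by move=> x y /=; rewrite -eG.
  move=> x y /= pxS pxy; apply: induced_val_inj.
  have [pxh|pxh] := eqVneq (p (induced_val x)) h; last first.
    by apply: single => //; rewrite inE negb_or pxh.
  have := induced_valP y; rewrite /N /= -pxy pxh eqxx /= => /eqP ->.
  by have := induced_valP x; rewrite /N /= pxh eqxx /= => /eqP ->.
apply: models_hereditary (hT v TN TB).
have /choice[f fP] : forall x : G, exists w : subst_vertex v B,
    match w with
    | inl a => p x != h /\ induced_val (val a) = x
    | inr b => p x = h /\ b = q x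
    end.
  move=> x; have [xM|xM] := eqVneq (p x) h; first by exists (inr (q x)).
  have [a ax] : exists a : induced N, induced_val a = x.
    by apply: induced_val_onto; rewrite /N /= xM.
  have av : a != v by apply: contraNneq xM => av; rewrite -ax av vE pu0.
  by exists (inl (exist _ a av)).
apply: (@embeds_subst _ _ _ _ f).
  move=> x y fxy; have := fP x; have := fP y; rewrite fxy.
  case: (f y) => [a|b] [py ey] [px ex]; first by rewrite -ey.
  by apply: inj; rewrite ?py// -ex.
move=> x y; have := fP x; have := fP y.
case: (f x) => [a|b]; case: (f y) => [a'|b'] [hy ey] [hx ex] /=.
- exact: (congr2 (fun x y => edge x y) ex ey).
- transitivity (edge x u0); first exact: (congr2 (fun x y => edge x y) ex vE).
  by rewrite !eG pu0 hy hx.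
- transitivity (edge u0 y); first exact: (congr2 (fun x y => edge x y) vE ey).
  by rewrite !eG pu0 hx eq_sym hy.
- by rewrite eG hx hy eqxx /= ex ey.
Qed.

End Lexicographic.

(** * Iterated lexicographic products *)

Section Levels.
Variable H : nat -> graph.
Hypothesis H_gt0 : forall n, (0 < gorder (H n))%N.
Local Open Scope nat_scope.

(** Adjacency on bare numbers, false out of range, so that digits carry no proof of their bounds. *)
Definition nat_edge (F : graph) (a b : nat) : bool :=
  if (insub a : option 'I_(gorder F)) is Some u then
    if (insub b : option 'I_(gorder F)) is Some v then @edge F u v else false
  else false.

Lemma nat_edgeE (F : graph) (u v : F) : nat_edge F u v = edge u v.
Proof.
rewrite /nat_edge (insubT (fun i => i < gorder F) (ltn_ord u)).
rewrite (insubT (fun i => i < gorder F) (ltn_ord v)).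
by congr edge; apply: val_inj.
Qed.

Lemma nat_edge_sym F a b : nat_edge F a b = nat_edge F b a.
Proof. by rewrite /nat_edge; case: insubP; case: insubP => // *; rewrite edge_sym. Qed.

Lemma nat_edge_irr F a : nat_edge F a a = false.
Proof. by rewrite /nat_edge; case: insubP => // *; rewrite edge_irr. Qed.

Definition level_size n := \prod_(j < n) gorder (H j).

Lemma level_sizeS n : level_size n.+1 = level_size n * gorder (H n).
Proof. by rewrite /level_size big_ord_recr. Qed.

Lemma level_size_gt0 n : 0 < level_size n.
Proof. exact: prodn_gt0. Qed.

(* The iterated lexicographic product [H 0 [H 1 [... [H n.-1]]]], its vertices
   being numbered in mixed radix. *)
Fixpoint level_edge n (a b : nat) : bool :=
  if n is n'.+1 then
    let m := gorder (H n') in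
    if a %/ m != b %/ m then level_edge n' (a %/ m) (b %/ m)
    else nat_edge (H n') (a %% m) (b %% m)
  else false.

Lemma level_edge_sym n a b : level_edge n a b = level_edge n b a.
Proof. by elim: n a b => //= n IH a b; rewrite eq_sym IH nat_edge_sym. Qed.

Lemma level_edge_irr n a : level_edge n a a = false.
Proof. by case: n => //= n; rewrite eqxx nat_edge_irr. Qed.

Definition level_graph n : graph :=
  @Graph (level_size n) (fun a b => level_edge n a b)
    (fun a b => level_edge_sym n a b) (fun a => level_edge_irr n a).

(** Level [n.+1] is a lexicographic product with [H n], with quotient and remainder by
    [gorder (H n)] as projections. *)
Lemma level_graph_models (T : universal_theory) n :
  closed_under_substitution (models T) -> (forall n, models T (H n)) ->
  models T (level_graph n).
Proof.
move=> hT TH; elim: n => [|n IH].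
  (* The empty product has one vertex and embeds in [H 0]. *)
  apply: (models_hereditary _ (TH 0)).
  have one (x y : level_graph 0) : x = y.
    have z0 (z : level_graph 0) : val z = 0.
      apply/eqP; rewrite -leqn0 -ltnS; apply: leq_trans (ltn_ord z) _.
      by rewrite /= /level_size big_ord0.
    by apply: val_inj; rewrite !z0.
  exists (fun _ => Ordinal (H_gt0 0)); split=> // u v.
  by rewrite (one u v) !edge_irr.
set m := gorder (H n).
have plt (x : level_graph n.+1) : x %/ m < level_size n.
  by rewrite ltn_divLR ?H_gt0// -level_sizeS; exact: (ltn_ord x).
have qlt (x : level_graph n.+1) : x %% m < m by rewrite ltn_mod H_gt0.
apply: (@lexicographic_models _ hT _ _ _
  (fun x => Ordinal (plt x) : level_graph n) (fun x => Ordinal (qlt x) : H n)) => //.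
  move=> x y /(congr1 val) /= ep /(congr1 val) /= eq; apply: val_inj.
  by rewrite /= (divn_eq x m) (divn_eq y m) ep eq.
by move=> x y; rewrite -val_eqE -(@nat_edgeE (H n)).
Qed.

(** An infinite branch of the tree of addresses: [c n] encodes the first [n] digits. *)
Definition coherent (c : nat -> nat) := forall n, c n = c n.+1 %/ gorder (H n).

Definition joined (c c' : nat -> nat) := exists n, level_edge n (c n) (c' n).

Lemma level_edge_stable c c' n n' : coherent c -> coherent c' ->
  c n != c' n -> n <= n' ->
  c n' != c' n' /\ level_edge n' (c n') (c' n') = level_edge n (c n) (c' n).
Proof.
move=> hc hc' neq /subnK <-; elim: (n' - n) => // k [IH1 IH2].
rewrite addSn /= -hc -hc' IH1; split=> //.
by apply: contraNneq IH1 => e; rewrite hc hc' e.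
Qed.

(** Equal addresses are never adjacent, so a level that joins two branches separates them; by
    [level_edge_stable] all separating levels agree. *)
Lemma joinedE c c' n : coherent c -> coherent c' -> c n != c' n ->
  joined c c' <-> level_edge n (c n) (c' n).
Proof.
move=> hc hc' neq; split=> [[k hk]|]; last by exists n.
have nk : c k != c' k by apply: contraTneq hk => ->; rewrite level_edge_irr.
have [/(level_edge_stable hc hc' nk)[_ ->]//|/ltnW] := leqP k n.
by move=> /(level_edge_stable hc hc' neq)[_ <-].
Qed.

Lemma coherent_leq c c' n n' : coherent c -> coherent c' ->
  n <= n' -> c n' = c' n' -> c n = c' n.
Proof.
move=> hc hc' nn' e; apply/eqP; apply: contraT => h.
by have [] := level_edge_stable hc hc' h nn'; rewrite e eqxx.
Qed.

(* The level at which a family of points splits cuts it into modules. *)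
Lemma prime_splits (F : graph) (x : F -> nat -> nat) n :
  prime_graph F -> 2 < gorder F -> (forall u, coherent (x u)) ->
  (forall u v, edge u v <-> joined (x u) (x v)) ->
  (forall u v, x u n = x v n) -> exists2 j, n <= j & embeds F (H j).
Proof.
move=> pF F3 cx ex xn; apply: contrapT => nemb.
have cst k : forall u v, x u (k + n) = x v (k + n).
  elim: k => [|k IH]; first by rewrite add0n.
  have split_edge u v : x u (k + n).+1 != x v (k + n).+1 ->
      edge u v = level_edge (k + n).+1 (x u (k + n).+1) (x v (k + n).+1).
    move=> uv; apply/idP/idP.
      by move=> /ex/(joinedE (cx u) (cx v) uv).
    by move=> /(joinedE (cx u) (cx v) uv)/ex.
  (* If this level is injective, the last digits alone embed [F] in [H (k + n)], since all points
     agree one level above. *)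
  have [inj|//] := @prime_fiber F (fun u => x u (k + n).+1) _ pF split_edge.
  case: nemb; exists (k + n); first exact: leq_addl.
  set j := k + n; set m := gorder (H j).
  have xlt u : x u j.+1 %% m < m by rewrite ltn_mod H_gt0.
  exists (fun u => Ordinal (xlt u) : H j); split=> [u v /(congr1 val) /= e|u v].
    apply: inj => /=; rewrite -/j (divn_eq (x u j.+1) m) (divn_eq (x v j.+1) m) e.
    by rewrite -!cx (IH u v).
  rewrite -(@nat_edgeE (H j)) /=.
  have [->|uv] := eqVneq u v; first by rewrite edge_irr nat_edge_irr.
  have xuv : x u j.+1 != x v j.+1 by apply: contraNneq uv => /inj ->.
  have E : level_edge j.+1 (x u j.+1) (x v j.+1) = nat_edge (H j) (x u j.+1 %% m) (x v j.+1 %% m).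
    by rewrite /= -!cx (IH u v) eqxx.
  rewrite -E; apply/idP/idP.
    by move=> /(joinedE (cx u) (cx v) xuv)/ex.
  by move=> /ex/(joinedE (cx u) (cx v) xuv).
have all_cst i u v : x u i = x v i.
  by apply: (@coherent_leq _ _ i (i + n)) => //; exact: leq_addr.
(* A family that never splits has no edge, which is impossible for a prime on more than two
   vertices. *)
have /(prime_edgeless pF) : forall u v : F, edge u v = false.
  by move=> u v; apply/negP => /ex[i]; rewrite (all_cst i u v) level_edge_irr.
by rewrite leqNgt F3.
Qed.

End Levels.

(** * Repeating each term as often as its size *)

Section Repetition.
Variable g : nat -> nat.
Hypothesis g_gt1 : forall k, (1 < g k)%N.
Local Open Scope nat_scope.

(* [(k, r)]: the current term is the occurrence number [r] of [k], out of [g k]. *)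
Fixpoint repeat_state (j : nat) : nat * nat :=
  if j is j'.+1 then
    let: (k, r) := repeat_state j' in
    if r.+1 < g k then (k, r.+1) else (k.+1, 0)
  else (0, 0).

Definition repeat_index j := (repeat_state j).1.

Lemma repeat_state_block k p : repeat_state p = (k, 0) ->
  (forall r, r < g k -> repeat_state (p + r) = (k, r)) /\
  repeat_state (p + g k) = (k.+1, 0).
Proof.
move=> hp; have h r : r < g k -> repeat_state (p + r) = (k, r).
  elim: r => [|r IH] hr; first by rewrite addn0.
  by rewrite addnS /= IH ?hr//; exact: ltnW.
split=> //; have gk : (g k).-1 < g k by rewrite prednK//; exact: ltnW.
by rewrite -(ltn_predK (g_gt1 k)) addnS /= h// prednK ?ltnn//; exact: ltnW.
Qed.

Lemma repeat_start k : exists p, repeat_state p = (k, 0).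
Proof.
elim: k => [|k [p hp]]; first by exists 0.
by exists (p + g k); have [] := repeat_state_block hp.
Qed.

Lemma repeat_index_mono i j : i <= j -> repeat_index i <= repeat_index j.
Proof.
move=> /subnK <-; elim: (j - i) => // k IH; apply: leq_trans IH _.
rewrite addSn /repeat_index /=; case: (repeat_state _) => a r /=.
by case: ifP => _ /=.
Qed.

Lemma repeat_index_leaves k : exists n, forall j, n <= j -> repeat_index j <> k.
Proof.
have [p hp] := repeat_start k.+1; exists p => j /repeat_index_mono.
by rewrite {1}/repeat_index hp /= => kj e; rewrite e ltnn in kj.
Qed.

(** This is [(1 - 1/m)^m <= 1/2], from the first two terms of the binomial expansion of
    [(q + 1)^(q + 1)] with [q = m - 1]. *)
Lemma double_predn_exp m : 1 < m -> 2 * m.-1 ^ m <= m ^ m.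
Proof.
case: m => [|[|m]] //= _; set q := m.+1.
have h n : q ^ n.+1 + n.+1 * q ^ n <= q.+1 ^ n.+1.
  elim: n => [|n IH]; first by rewrite !expn1 expn0 muln1 addn1.
  rewrite [leqRHS]expnS; apply: leq_trans (leq_mul (leqnn _) IH).
  rewrite !expnS; set t := q ^ n; nia.
apply: leq_trans (h q); rewrite mul2n -addnn leq_add2l expnS leq_mul2r leqnSn.
by rewrite orbT.
Qed.

(** Each block of [g k] repetitions at least halves the ratio of the products. The induction stops
    at the start of a block so that a whole block can be appended. *)
Lemma repeat_prod k : exists n,
  2 ^ k * \prod_(j < n) (g (repeat_index j)).-1 <= \prod_(j < n) g (repeat_index j).
Proof.
suff [n [_ hn]] : exists n, repeat_state n = (k, 0) /\
    2 ^ k * \prod_(j < n) (g (repeat_index j)).-1 <= \prod_(j < n) g (repeat_index j).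
  by exists n.
elim: k => [|k [p [hp IH]]]; first by exists 0; rewrite !big_ord0.
have [h1 h2] := repeat_state_block hp; exists (p + g k); split=> //.
have blk (f : nat -> nat) : \prod_(j < p + g k) f (g (repeat_index j)) =
    \prod_(j < p) f (g (repeat_index j)) * f (g k) ^ g k.
  rewrite big_split_ord /=; congr muln.
  rewrite (eq_bigr (fun _ => f (g k))) => [|i _]; last by rewrite /repeat_index h1.
  by rewrite prod_nat_const card_ord.
rewrite (blk predn) (blk id); apply: leq_trans (leq_mul IH (double_predn_exp (g_gt1 k))).
by rewrite expnS [2 * _]mulnC -!mulnA leq_mul2l mulnCA leqnn orbT.
Qed.

End Repetition.

(** * The graphon of an iterated lexicographic product *)

Section AddressedSpace.
Context {R : realType} {d : measure_display} {X : measurableType d}.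
Variables (H : nat -> graph) (mu : probability X R) (addr : nat -> X -> nat).
Hypothesis H_gt1 : forall n, (1 < gorder (H n))%N.
Let M := level_size H.
Let cyl n a := [set x | addr n x = a].
Hypothesis measurable_cyl : forall n a, measurable (cyl n a).
Hypothesis mu_cyl : forall n a, (a < M n)%N -> mu (cyl n a) = ((M n)%:R^-1)%:E.
Hypothesis addr_coherent : forall x, coherent H (addr ^~ x).

Let H_gt0 n : (0 < gorder (H n))%N. Proof. exact: ltnW. Qed.
Let M_gt0 n : (0 < M n)%N. Proof. exact: level_size_gt0. Qed.
Let MR_gt0 n : 0 < (M n)%:R :> R. Proof. by rewrite ltr0n. Qed.

Definition tree_fun (x y : X) : R := (`[< joined H (addr ^~ x) (addr ^~ y) >])%:R.

Lemma tree_fun_sym x y : tree_fun x y = tree_fun y x.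
Proof.
rewrite /tree_fun; congr (_%:R); congr nat_of_bool; apply/asboolP/asboolP.
  by move=> [n h]; exists n; rewrite level_edge_sym.
by move=> [n h]; exists n; rewrite level_edge_sym.
Qed.

Lemma tree_fun_itv x y : 0 <= tree_fun x y <= 1.
Proof. by rewrite /tree_fun; case: asbool; rewrite ?lexx ler01. Qed.

Lemma tree_funE n x y : addr n x != addr n y ->
  tree_fun x y = (level_edge H n (addr n x) (addr n y))%:R.
Proof.
move=> h; rewrite /tree_fun; congr (_%:R); congr nat_of_bool; apply/asboolP/idP.
  by move/(joinedE (addr_coherent x) (addr_coherent y) h).
by move/(joinedE (addr_coherent x) (addr_coherent y) h).
Qed.

Lemma measurable_tree_fun : measurable_fun setT (fun p : X * X => tree_fun p.1 p.2).
Proof.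
pose B := \bigcup_n \bigcup_a \bigcup_b
  ([set p : X * X | level_edge H n a b] `&` (cyl n a `*` cyl n b)).
have mB : measurable B.
  apply: bigcupT_measurable => n; apply: bigcupT_measurable => a.
  apply: bigcupT_measurable => b; apply: measurableI.
    have [h|h] := boolP (level_edge H n a b).
      by rewrite (_ : mkset _ = setT) //; apply/seteqP; split.
    by rewrite (_ : mkset _ = set0) //; apply/seteqP; split.
  exact: measurableX.
rewrite (_ : (fun p => _) = \1_B); first exact: measurable_indic.
apply/funext => p; rewrite /tree_fun indicE; congr (_%:R); congr nat_of_bool.
apply/asboolP/idP => [[n h]|]; rewrite in_setE.
  exists n => //; exists (addr n p.1) => //; exists (addr n p.2) => //.
by move=> [n _ [a _ [b _ [/= h [/= ea eb]]]]]; exists n; rewrite ea eb.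
Qed.

(** Addresses out of range may occur, but the cylinders in range already have total mass 1. *)
Lemma outside_negligible n : mu.-negligible [set x | (M n <= addr n x)%N].
Proof.
pose D := \big[setU/set0]_(i < M n) cyl n i.
have mD : measurable D by apply: bigsetU_measurable.
have muD : mu D = 1%E.
  rewrite /D (measure_bigsetU mu (F := cyl n)) //; last first.
    apply/trivIsetP => i j _ _ ij; apply/seteqP; split=> // x [/= ei ej].
    by move: ij; rewrite -ei -ej eqxx.
  rewrite (eq_bigr (fun=> ((M n)%:R^-1)%:E)) => [|i _]; last exact: mu_cyl.
  by rewrite sumEFin sumr_const card_ord -(mulr_natr (M n)%:R^-1) mulVf// gt_eqF.
exists (~` D); split.
- exact: measurableC.
- by rewrite probability_setC// muD subee.
- move=> x /= Mx; rewrite /D -(bigcup_mkord (M n) (cyl n)) => -[i /= iM] e.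
  by rewrite e leqNgt iM in Mx.
Qed.

Lemma addr_negligible n N : measurable N ->
  (forall a, (a < M n)%N -> mu.-negligible (N `&` cyl n a)) ->
  mu.-negligible N.
Proof.
move=> mN h; apply: (@negligibleS _ _ _ mu
   ((\bigcup_a [set x | (a < M n)%N /\ N x /\ cyl n a x]) `|` [set x | (M n <= addr n x)%N])).
  by move=> x Nx; have [|lt] := leqP (M n) (addr n x); [right|left; exists (addr n x)].
apply: negligibleU (outside_negligible n); apply: negligible_bigcup => a.
have [/h|nlt] := boolP (a < M n)%N; first by apply: negligibleS => x /= [_].
by apply: negligibleS (negligible_set0 mu) => x [].
Qed.

Lemma level_size_exp n : (2 ^ n <= M n)%N.
Proof.
rewrite /M; elim: n => [|n IH]; first by rewrite /level_size big_ord0.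
by rewrite level_sizeS expnSr leq_mul.
Qed.

Lemma level_size_cvg : ((M n)%:R^-1 : R) @[n --> \oo] --> (0 : R).
Proof.
apply: (@squeeze_cvgr _ _ _ _ (fun=> 0) (fun n : nat => n.+1%:R^-1)).
- near=> n; rewrite invr_ge0 ler0n /= lef_pV2 ?posrE ?ltr0n// ler_nat.
  exact: leq_trans (ltn_expl n _) (level_size_exp n).
- exact: cvg_cst.
- exact: cvg_harmonic.
Unshelve. all: by end_near. Qed.

(** At a level whose cylinders have mass below [mu A], some cylinder meets [A] in a positive set, of
    smaller measure. *)
Lemma addressed_atomless : atomless mu.
Proof.
move=> A mA A_gt0.
have muA : mu A \is a fin_num by exact: fin_num_measure.
have e_gt0 : 0 < fine (mu A) by rewrite -lte_fin fineK.
have [n hn] : exists n, (M n)%:R^-1 < fine (mu A).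
  have [n _ /(_ n (leqnn n)) /= hn] := cvgr_lt _ level_size_cvg _ e_gt0.
  by exists n.
have [a [aM nA]] : exists a, (a < M n)%N /\ ~ mu.-negligible (A `&` cyl n a).
  apply: contrapT => h; have /negligibleP : mu.-negligible A.
    apply: (@addr_negligible n) => // a aM; apply: contrapT => nA; apply: h.
    by exists a.
  by move=> /(_ mA) A0; rewrite A0 ltxx in A_gt0.
have mAC : measurable (A `&` cyl n a) by exact: measurableI.
exists (A `&` cyl n a); split=> //.
  rewrite lt_def measure_ge0 andbT; apply/eqP => h; apply: nA; exact/negligibleP.
apply: (@le_lt_trans _ _ (mu (cyl n a))); first by apply: le_measure; rewrite ?inE.
by rewrite mu_cyl// -(fineK muA) lte_fin.
Qed.

(** The address at level [n] is uniformly distributed over the values in range. *)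
Lemma integral_addr n (h : nat -> R) : (forall a, 0 <= h a) ->
  (\int[mu]_x (h (addr n x))%:E = ((\sum_(a < M n) h a) / (M n)%:R)%:E)%E.
Proof.
move=> h0.
have mh : measurable_fun setT (fun x => (h (addr n x))%:E : \bar R).
  move=> _ Y mY; rewrite setTI.
  rewrite (_ : _ @^-1` _ = \bigcup_(a in [set a | Y (h a)%:E]) cyl n a).
    by apply: bigcup_measurable.
  apply/seteqP; split=> x /=; first by move=> hx; exists (addr n x).
  by move=> [a ha ->].
have mI (a : 'I_(M n)) : measurable_fun setT (fun x => (h a * \1_(cyl n a) x)%:E : \bar R).
  apply/measurable_EFinP; apply: measurable_funM; first exact: measurable_cst.
  exact: measurable_indic.
rewrite (@ge0_ae_eq_integral _ _ _ mu setT _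
    (fun x => \sum_(a < M n) (h a * \1_(cyl n a) x)%:E)%E) //.
- rewrite ge0_integral_sum //; last first.
    by move=> a x _; rewrite lee_fin mulr_ge0.
  rewrite mulr_suml -sumEFin; apply: eq_bigr => a _.
  under eq_integral do rewrite EFinM.
  rewrite ge0_integralZl_EFin//; last exact/measurable_EFinP/measurable_indic.
    by rewrite integral_indic// setIT EFinM; congr (_ * _)%E; exact: mu_cyl.
- exact: emeasurable_sum.
- by move=> x _; rewrite lee_fin.
- by move=> x _; rewrite sumEFin lee_fin sumr_ge0// => a _; rewrite mulr_ge0.
apply: negligibleS (outside_negligible n) => x /= /not_implyP[_ hx].
rewrite leqNgt; apply/negP => ltx; apply: hx.
rewrite (bigD1 (Ordinal ltx))//= big1 ?adde0 => [|a ax].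
  by rewrite indicE mem_set// mulr1.
rewrite indicE memNset ?mulr0// /cyl /= => e; move/eqP: ax; apply.
by apply: val_inj; rewrite /= e.
Qed.

Lemma sum_ffun_cons (k m : nat) (phi : seq nat -> R) :
  \sum_(f : {ffun 'I_k.+1 -> 'I_m}) phi [seq (f i : nat) | i <- enum 'I_k.+1] =
  \sum_(a < m) \sum_(f : {ffun 'I_k -> 'I_m})
    phi ((a : nat) :: [seq (f i : nat) | i <- enum 'I_k]).
Proof.
rewrite pair_big /=.
pose c (p : 'I_m * {ffun 'I_k -> 'I_m}) : {ffun 'I_k.+1 -> 'I_m} :=
  [ffun i => if unlift ord0 i is Some j then p.2 j else p.1].
rewrite (reindex c) /=; last first.
  exists (fun f => (f ord0, [ffun j => f (lift ord0 j)])) => [[a f] _|f _].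
    rewrite /c ffunE unlift_none; congr pair; apply/ffunP => j.
    by rewrite !ffunE liftK.
  apply/ffunP => i; rewrite ffunE; case: unliftP => [j ->|->] //=.
  by rewrite ffunE.
apply: eq_bigr => -[a f] _ /=; congr phi; rewrite enum_ordSl /= /c ffunE unlift_none.
congr cons; rewrite -map_comp; apply: eq_map => i /=.
by rewrite ffunE liftK.
Qed.

Lemma integral_tuple_addr n k (phi : seq nat -> R) : (forall s, 0 <= phi s) ->
  integral_tuple mu (fun t : k.-tuple X => (phi [seq addr n x | x <- t])%:E) =
  ((\sum_(f : {ffun 'I_k -> 'I_(M n)}) phi [seq (f i : nat) | i <- enum 'I_k])
     / (M n)%:R ^+ k)%:E.
Proof.
elim: k phi => [|k IH] phi phi0 /=.
  rewrite (eq_bigr (fun=> phi [::])) => [|f _]; last first.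
    by rewrite (size0nil (s := enum 'I_0)) // -cardE card_ord.
  by rewrite sumr_const card_ffun !card_ord expn0 expr0 divr1.
pose h a := (\sum_(f : {ffun 'I_k -> 'I_(M n)})
  phi (a :: [seq (f i : nat) | i <- enum 'I_k])) / (M n)%:R ^+ k.
rewrite (_ : integral _ _ _ = \int[mu]_x (h (addr n x))%:E)%E; last first.
  by apply: eq_integral => x _; rewrite -(IH (fun s => phi (addr n x :: s))).
rewrite integral_addr => [|a]; last first.
  by rewrite divr_ge0 ?exprn_ge0 ?ler0n// sumr_ge0.
by rewrite sum_ffun_cons /h -mulr_suml exprSr invfM mulrA.
Qed.

(** The sequence of addresses takes countably many values, each on a measurable set. *)
Lemma measurable_addr_tuple n k (phi : seq nat -> R) :
  measurable_fun setT (fun t : k.-tuple X => (phi [seq addr n x | x <- t])%:E).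
Proof.
move=> _ Y mY; rewrite setTI.
pose B s := [set t : k.-tuple X | forall i : 'I_k, addr n (tnth t i) = nth 0%N s i].
rewrite (_ : _ @^-1` _ =
    \bigcup_(s in [set s | size s = k /\ Y (phi s)%:E]) B s).
  rewrite bigcup_mkcond; apply: countable_bigcupT_measurable => [|s].
    exact: countableP.
  case: ifP => // _; apply: measurable_forall => i.
  exact: (measurable_preimage (measurable_tnth i) (measurable_cyl n _)).
apply/seteqP; split=> t /=.
  move=> Yt; exists [seq addr n x | x <- t]; first by rewrite /= size_map size_tuple.
  move=> i; have x0 := tnth t i.
  by rewrite (nth_map x0) ?size_tuple// (tnth_nth x0).
move=> [s [/= sk Ys] Bs]; rewrite (_ : map _ _ = s)//.
apply: (@eq_from_nth _ 0%N); first by rewrite size_map size_tuple sk.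
move=> i; rewrite size_map size_tuple => ik.
have x0 := tnth t (Ordinal ik).
by rewrite -(Bs (Ordinal ik)) (nth_map x0) ?size_tuple// (tnth_nth x0).
Qed.

(** * Densities of the finite levels converge to those of the graphon *)

Section Convergence.
Variables (F : graph) (W : graphon R X).
Hypothesis gmeasW : gmeas W = mu.
Hypothesis gfunW : forall x y, W x y = tree_fun x y.
(** [s] holds the addresses of the vertices; repetitions are excluded because equal addresses leave
    the adjacency undecided. *)
Let matches n (s : seq nat) : bool := uniq s &&
  [forall u : F, forall v : F,
     (u != v) ==> (level_edge H n (nth 0%N s u) (nth 0%N s v) == edge u v)].

Let integrand (t : (gorder F).-tuple X) : R :=
  \prod_(p : 'I_(gorder F) * 'I_(gorder F) | (p.1 < p.2)%N)
     let w := W (tnth t p.1) (tnth t p.2) in if edge p.1 p.2 then w else 1 - w.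

Lemma integrand_itv t : 0 <= integrand t <= 1.
Proof.
suff h (p : 'I_(gorder F) * 'I_(gorder F)) : 0 <= (let w := W (tnth t p.1) (tnth t p.2) in
    if edge p.1 p.2 then w else 1 - w) <= 1.
  rewrite prodr_ge0/=; last by move=> p _; have /andP[] := h p.
  by apply: prodr_ile1 => p _; exact: h.
have /andP[w0 w1] := graphon_itv W (tnth t p.1) (tnth t p.2).
by case: edge => /=; rewrite ?w0 ?w1// subr_ge0 w1 gerBl.
Qed.

(** Distinct addresses decide all adjacencies, and the integrand is then 0 or 1; otherwise only the
    bounds 0 and 1 remain. *)
Lemma integrand_bounds n (t : (gorder F).-tuple X) (s := [seq addr n x | x <- t]) :
  (matches n s)%:R <= integrand t <= (matches n s)%:R + (~~ uniq s)%:R.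
Proof.
have /andP[i0 i1] := integrand_itv t.
rewrite /matches; have [us|nus] /= := boolP (uniq s); last by rewrite add0r i0.
rewrite addr0 -eq_le; apply/eqP.
have Wst (u v : F) : u != v ->
    W (tnth t u) (tnth t v) = (level_edge H n (nth 0%N s u) (nth 0%N s v))%:R.
  move=> uv; have x0 := tnth t u.
  have nthE (w : F) : nth 0%N s w = addr n (tnth t w).
    by rewrite (nth_map x0) ?size_tuple// (tnth_nth x0).
  rewrite gfunW !nthE; apply: tree_funE; rewrite -!nthE nth_uniq//;
    by rewrite size_map size_tuple ltn_ord.
have [/'forall_forallP h|] := boolP [forall u : F, forall v : F, (u != v) ==>
  (level_edge H n (nth 0%N s u) (nth 0%N s v) == edge u v)].
  rewrite /integrand big1// => -[u v] /= uv.
  have neq : u != v by rewrite -val_eqE /= ltn_eqF.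
  rewrite Wst//; have /implyP/(_ neq)/eqP -> := h u v.
  by case: edge; rewrite //= subr0.
rewrite negb_forall => /existsP[u]; rewrite negb_forall => /existsP[v].
rewrite negb_imply => /andP[uv hne].
have key (a b : F) : (a < b)%N ->
    level_edge H n (nth 0%N s a) (nth 0%N s b) != edge a b -> integrand t = 0.
  move=> ab nab; rewrite /integrand (bigD1 (a, b))//= Wst; last first.
    by rewrite -val_eqE /= ltn_eqF.
  move: nab; case: edge; case: level_edge => //= _; first by rewrite mul0r.
  by rewrite subrr mul0r.
move: (uv); rewrite -val_eqE neq_ltn => /orP[/key|/key] /= -> //.
by rewrite level_edge_sym edge_sym.
Qed.

Lemma measurable_integrand : measurable_fun setT (fun t : (gorder F).-tuple X => (integrand t)%:E).
Proof.
apply/measurable_EFinP; rewrite /integrand.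
under eq_fun => t do rewrite big_mkcond /=.
apply: measurable_prod => p _; case: (p.1 < p.2)%N; last exact: measurable_cst.
have mw : measurable_fun setT (fun t : (gorder F).-tuple X => W (tnth t p.1) (tnth t p.2)).
  by apply: (measurable_W (graphon_measurable W)); exact: measurable_tnth.
case: (edge p.1 p.2) => //; apply: measurable_funB => //; exact: measurable_cst.
Qed.

Let matching_card n : nat :=
  #|[pred f : {ffun F -> level_graph H n} |
      injectiveb f && [forall u, forall v, edge (f u) (f v) == edge u v]]|.

Lemma matchesE n (f : {ffun F -> level_graph H n}) :
  matches n [seq (f i : nat) | i <- enum 'I_(gorder F)] =
  injectiveb f && [forall u, forall v, edge (f u) (f v) == edge u v].
Proof.
have nthE (w : F) : nth 0%N [seq (f i : nat) | i <- enum 'I_(gorder F)] w = f w.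
  by rewrite (nth_map w) ?nth_ord_enum// size_enum_ord ltn_ord.
have uE : uniq [seq (f i : nat) | i <- enum 'I_(gorder F)] = injectiveb f.
  by rewrite (map_comp val f) (map_inj_uniq val_inj).
rewrite /matches uE; congr andb; apply/'forall_forallP/'forall_forallP => h u v.
  have [->|uv] := eqVneq u v; first by rewrite !edge_irr.
  by have := h u v; rewrite uv /= !nthE.
by apply/implyP => _; rewrite !nthE; exact: h.
Qed.

Lemma sum_matches n :
  \sum_(f : {ffun 'I_(gorder F) -> 'I_(M n)})
     (matches n [seq (f i : nat) | i <- enum 'I_(gorder F)])%:R =
  (matching_card n)%:R :> R.
Proof.
rewrite -natr_sum; congr (_%:R); rewrite /matching_card -sum1_card [RHS]big_mkcond /=.
by apply: eq_bigr => f _; rewrite (@matchesE n f) inE; case: (_ && _).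
Qed.

Lemma sum_not_uniq n :
  \sum_(f : {ffun 'I_(gorder F) -> 'I_(M n)})
     (~~ uniq [seq (f i : nat) | i <- enum 'I_(gorder F)])%:R =
  (M n)%:R ^+ gorder F - (M n ^_ gorder F)%:R :> R.
Proof.
have -> : (M n ^_ gorder F)%:R = \sum_(f : {ffun 'I_(gorder F) -> 'I_(M n)})
     (uniq [seq (f i : nat) | i <- enum 'I_(gorder F)])%:R :> R.
  rewrite -natr_sum; congr (_%:R).
  have := card_inj_ffuns 'I_(gorder F) 'I_(M n); rewrite !card_ord => <-.
  rewrite -sum1_card big_mkcond /=; apply: eq_bigr => f _; rewrite inE.
  by rewrite (map_comp val f) (map_inj_uniq val_inj) /injectiveb /dinjectiveb; case: uniq.
rewrite -natrX (_ : (M n ^ gorder F)%N = #|{ffun 'I_(gorder F) -> 'I_(M n)}|); last first.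
  by rewrite card_ffun !card_ord.
rewrite -[X in X%:R - _](sum1_card) natr_sum -sumrB; apply: eq_bigr => f _.
by case: uniq; rewrite /= ?subrr ?subr0.
Qed.

Lemma graph_densityE n :
  graph_density F (level_graph H n) = (matching_card n)%:R / (M n ^_ gorder F)%:R :> R.
Proof.
rewrite /graph_density; congr (_%:R / _); apply: eq_card => f; rewrite [RHS]inE.
by apply/idP/idP => [|h]; rewrite in_setE.
Qed.

Lemma matching_card_le n : (matching_card n <= M n ^_ gorder F)%N.
Proof.
have := card_inj_ffuns 'I_(gorder F) 'I_(M n); rewrite !card_ord => <-.
by apply/subset_leq_card/fintype.subsetP => f; rewrite !inE => /andP[].
Qed.

(** The probability that [gorder F] independent uniform addresses are distinct. *)
Let ratio n : R := (M n ^_ gorder F)%:R / (M n)%:R ^+ gorder F.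

(** [ratio n * g] is the probability that the addresses are distinct and span [F]; repeated
    addresses contribute at most [1 - ratio n]. *)
Lemma density_sandwich n (g := graph_density F (level_graph H n) : R) :
  ((ratio n * g)%:E <= graphon_density F W <= (ratio n * g + (1 - ratio n))%:E)%E.
Proof.
have Mk : (M n)%:R ^+ gorder F != 0 :> R by rewrite expf_eq0 gt_eqF ?andbF.
have rgE : ratio n * g = (matching_card n)%:R / (M n)%:R ^+ gorder F.
  rewrite /g graph_densityE /ratio.
  (* For [M n] below the order of [F] the denominator is 0 and the quotient is 0 by convention;
     nothing matches then. *)
  have [M0|M0] := eqVneq (M n ^_ gorder F)%N 0%N.
    by have := matching_card_le n; rewrite M0 leqn0 => /eqP ->; rewrite !mul0r.
  by rewrite mulrC mulrA divfK// pnatr_eq0.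
have -> : graphon_density F W =
    integral_tuple mu (fun t : (gorder F).-tuple X => (integrand t)%:E).
  by rewrite /graphon_density gmeasW.
have i0 t : (0 <= (integrand t)%:E)%E by have /andP[] := integrand_itv t.
rewrite rgE; apply/andP; split.
  rewrite -sum_matches -(@integral_tuple_addr n (gorder F) (fun s => (matches n s)%:R))//.
  apply: le_integral_tuple => //.
  - exact: (@measurable_addr_tuple n (gorder F) (fun s => (matches n s)%:R)).
  - exact: measurable_integrand.
  - by move=> t; rewrite lee_fin; have /andP[] := integrand_bounds n t.
pose phi s : R := (matches n s)%:R + (~~ uniq s)%:R.
rewrite (_ : (_ + _)%:E = integral_tuple mu
    (fun t : (gorder F).-tuple X => (phi [seq addr n x | x <- t])%:E)).
  apply: le_integral_tuple => //.
  - exact: measurable_integrand.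
  - exact: (@measurable_addr_tuple n (gorder F) phi).
  - by move=> t; rewrite lee_fin; have /andP[] := integrand_bounds n t.
rewrite integral_tuple_addr; last by move=> s; rewrite addr_ge0.
congr EFin; rewrite /phi big_split /= sum_matches sum_not_uniq /ratio.
by rewrite mulrDl mulrBl divff.
Qed.

(** Each further vertex contributes a factor [(M n - k) / M n], which tends to 1. *)
Lemma ratio_cvg : ratio n @[n --> \oo] --> (1 : R).
Proof.
rewrite /ratio; elim: (gorder F) => [|k IH].
  by under eq_fun => n do rewrite ffactn0 expr0 divr1; exact: cvg_cst.
have E n : (M n ^_ k.+1)%:R / (M n)%:R ^+ k.+1 =
    ((M n ^_ k)%:R / (M n)%:R ^+ k) * ((M n - k)%:R / (M n)%:R) :> R.
  by rewrite ffactnSr natrM exprSr invfM mulrACA.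
under eq_fun => n do rewrite E.
suff h : ((M n - k)%:R / (M n)%:R : R) @[n --> \oo] --> (1 : R).
  have := cvgM IH h; rewrite mulr1. exact.
apply: (@squeeze_cvgr _ _ _ _ (fun n => 1 - k%:R * (M n)%:R^-1) (fun=> 1)).
- near=> n; apply/andP; split.
    rewrite lerBlDr -mulrDl ler_pdivlMr// mul1r -natrD ler_nat.
    by rewrite addnC -maxnE leq_maxr.
  by rewrite ler_pdivrMr// mul1r ler_nat leq_subr.
- have : (1 - k%:R * (M n)%:R^-1 : R) @[n --> \oo] --> (1 - k%:R * 0 : R).
    apply: cvgB; first exact: cvg_cst.
    by apply: cvgM; [exact: cvg_cst|exact: level_size_cvg].
  by rewrite mulr0 subr0.
- exact: cvg_cst.
Unshelve. all: by end_near. Qed.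

Lemma level_density_cvg :
  ((graph_density F (level_graph H n))%:E @[n --> \oo] --> graphon_density F W)%E.
Proof.
have fD : graphon_density F W \is a fin_num.
  have /andP[lo hi] := density_sandwich 0.
  rewrite fin_real// (lt_le_trans (ltNyr _) lo)/=.
  exact: le_lt_trans hi (ltry _).
rewrite -(fineK fD); set D := fine _; apply: cvg_EFin; first exact: nearW.
(* With [r = ratio n] and [0 <= g <= 1], both [g] and [D] lie between [r * g] and
   [r * g + (1 - r)]. *)
apply: (@squeeze_cvgr _ _ _ _ (fun n => D - (1 - ratio n)) (fun n => D + (1 - ratio n))).
- near=> n; have := density_sandwich n; rewrite /= -(fineK fD) !lee_fin -/D.
  set g := graph_density _ _; set r := ratio n => /andP[lo hi].
  have g0 : 0 <= g by rewrite /g graph_densityE divr_ge0.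
  have g1 : g <= 1.
    rewrite /g graph_densityE; have [->|M0] := eqVneq (M n ^_ gorder F)%N 0%N.
      by rewrite invr0 mulr0 ler01.
    by rewrite ler_pdivrMr ?ltr0n ?lt0n// mul1r ler_nat matching_card_le.
  have r1 : r <= 1.
    rewrite /r /ratio ler_pdivrMr ?exprn_gt0// mul1r -natrX ler_nat ffact_prod.
    rewrite -[X in (_ <= _ ^ X)%N]card_ord -prod_nat_const leq_prod// => i _.
    exact: leq_subr.
  have rg : (1 - r) * g <= 1 - r by rewrite ler_piMr// subr_ge0.
  have gE : g = r * g + (1 - r) * g by rewrite mulrBl mul1r addrC subrK.
  apply/andP; split; last by rewrite [leLHS]gE lerD.
  by rewrite lerBlDr (le_trans hi)// lerD2r ler_piMl.
- have : (D - (1 - ratio n)) @[n --> \oo] --> (D - (1 - 1)).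
    by apply: cvgB; [exact: cvg_cst|apply: cvgB ratio_cvg; exact: cvg_cst].
  by rewrite subrr subr0.
- have : (D + (1 - ratio n)) @[n --> \oo] --> (D + (1 - 1)).
    by apply: cvgD; [exact: cvg_cst|apply: cvgB ratio_cvg; exact: cvg_cst].
  by rewrite subrr addr0.
Unshelve. all: by end_near. Qed.

End Convergence.

(** Otherwise the choices of one point of [A] in each child of the cylinder form a box with
    non-negligible sides, and every choice spans [H n]. *)
Lemma null_child (x0 : X) A n a :
  ~ positive_in x0 tree_fun mu A (H n) ->
  exists2 i, (i < gorder (H n))%N &
    mu.-negligible (A `&` cyl n.+1 (a * gorder (H n) + i)).
Proof.
move=> nA; apply: contrapT => h; apply: nA; set m := gorder (H n) in h *.
pose B i := A `&` cyl n.+1 (a * m + i).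
have := @null_box _ _ _ mu m B x0 _; rewrite /positive_in -/m => box.
apply: contra_not (box _) => [|i im nB]; last by apply: h; exists i.
apply: null_sub => s sm Bs; split=> [u v uv|x /(nthP x0)[i]]; last first.
  by rewrite sm => /Bs[Ai _] <-.
have [_ /= au] := Bs u (ltn_ord u); have [_ /= av] := Bs v (ltn_ord v).
have um (w : H n) : ((a * m + w) %/ m = a)%N.
  by rewrite divnMDl ?H_gt0// divn_small ?addn0 ?ltn_ord.
have wm (w : H n) : ((a * m + w) %% m = w)%N by rewrite modnMDl modn_small// ltn_ord.
rewrite (@tree_funE n.+1) ?au ?av ?eqn_add2l//= !um eqxx /= !wm nat_edgeE.
by case: edge; rewrite ?ltr01.
Qed.

(** At each level a cylinder has a child that is null in [A], so after [l] levels only a product of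
    the [(gorder (H _)).-1] of the cylinders of mass [1 / M (n + l)] can count. *)
Lemma mu_cyl_le (x0 : X) A l n a : measurable A ->
  (forall n, ~ positive_in x0 tree_fun mu A (H n)) -> (a < M n)%N ->
  (mu (A `&` cyl n a) <=
   ((\prod_(j < l) (gorder (H (n + j))).-1)%:R / (M (n + l))%:R)%:E)%E.
Proof.
move=> mA nA; elim: l n a => [|l IH] n a aM.
  rewrite big_ord0 addn0 mul1r -(mu_cyl aM).
  by apply: le_measure; rewrite ?inE//; exact: measurableI.
set m := gorder (H n).
pose B i := A `&` cyl n.+1 (a * m + i).
have mB i : measurable (B i) by exact: measurableI.
have [i0 i0m] := null_child a (nA n); rewrite -/m => /(measure_negligible (mB i0)) B0.
apply: (@le_trans _ _ (mu (\big[setU/set0]_(i < m) B i))).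
  apply: le_measure; rewrite ?inE; first exact: measurableI.
    by apply: bigsetU_measurable.
  rewrite -bigcup_mkord => x [Ax /= ax].
  exists (addr n.+1 x %% m)%N; first by rewrite /= ltn_mod H_gt0.
  split=> //; have -> : a = (addr n.+1 x %/ m)%N by rewrite -ax; exact: addr_coherent.
  exact: divn_eq.
apply: (le_trans (le_mu_bigsetU mu (fun i _ => mB i))).
(* The null child [i0] is dropped; the [m.-1] others are bounded by induction. *)
rewrite (bigD1 (Ordinal i0m)) //= B0 add0e.
rewrite big_ord_recl /= addn0 natrM -mulrA.
rewrite (eq_bigr (fun j : 'I_l => (gorder (H (n.+1 + j))).-1)) => [|j _]; last first.
  by rewrite /bump /= add1n addSnnS.
rewrite -addSnnS -/m; set q := (_ / _) in IH *.
rewrite (_ : ((m.-1)%:R * q)%:E = (\sum_(i < m | i != Ordinal i0m) q%:E)%E).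
  apply: lee_sum => i _; apply: IH; rewrite /M level_sizeS -/m.
  by apply: leq_trans (_ : (a * m + m <= _)%N); rewrite ?ltn_add2l// -mulSnr leq_mul2r aM orbT.
by rewrite sumEFin sumr_const cardC1 card_ord mulr_natl.
Qed.

Hypothesis prod_small : forall k, exists n,
  (2 ^ k * \prod_(j < n) (gorder (H j)).-1 <= M n)%N.

Lemma some_level_positive (x0 : X) A : measurable A -> ~ mu.-negligible A ->
  exists n, positive_in x0 tree_fun mu A (H n).
Proof.
move=> mA nA; apply: contrapT => h; apply: nA.
have {}h n : ~ positive_in x0 tree_fun mu A (H n) by move=> hn; apply: h; exists n.
apply: (@addr_negligible 0) => // a aM.
have mAC : measurable (A `&` cyl 0 a) by exact: measurableI.
apply/negligibleP => //; apply/eqP; rewrite eq_le measure_ge0 andbT leNgt.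
apply/negP => pos; have fin : mu (A `&` cyl 0 a) \is a fin_num by exact: fin_num_measure.
set e := fine (mu (A `&` cyl 0 a)).
have e_gt0 : 0 < e by rewrite -lte_fin /e fineK.
(* This [k] gives [e^-1 < k < 2 ^ k], so the bound at level [l] falls below [e]. *)
pose k := (Num.truncn e^-1).+1; have [l hl] := prod_small k.
have := mu_cyl_le l mA h aM; rewrite -(fineK fin) lee_fin -/e add0n.
apply/negP; rewrite -ltNge ltr_pdivrMr//.
have ke : 1 < e * (2 ^ k)%:R.
  rewrite -ltr_pdivrMl// mulr1; apply: lt_trans (truncnS_gt _) _.
  by rewrite ltr_nat ltn_expl.
have := hl; rewrite -(ler_nat R) natrM => hl'.
apply: lt_le_trans (_ : e * ((2 ^ k)%:R * (\prod_(j < l) (gorder (H j)).-1)%:R) <= _).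
  rewrite mulrA -[ltLHS]mul1r ltr_pM2r// ltr0n prodn_gt0// => j.
  by rewrite -subn1 subn_gt0.
by rewrite ler_pM2l.
Qed.

Hypothesis H_prime : forall n, prime_graph (H n).
Hypothesis H_gt2 : forall n, (2 < gorder (H n))%N.
Hypothesis H_leaves : forall n, exists n', forall j, (n' <= j)%N -> ~ embeds (H n) (H j).

Lemma tree_graphon_not_weakly_random (W W' : graphon R X) :
  gmeas W = mu -> (forall x y, W x y = tree_fun x y) ->
  is_subgraphon W' W -> ~ weakly_random W'.
Proof.
move=> muW eW sW' wr; have x0 := probability_inhabited mu.
have [A mA cA] := subgraphon_support sW'; rewrite muW in cA.
have nA := concentrated_not_negligible cA.
have [n posn] := some_level_positive x0 mA nA.
have eW' x y : W' x y = tree_fun x y by rewrite sW'.1 eW.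
have QH : Q W' (H n).
  apply/(Q_concentrated x0 (H n) sW'.1 cA).
  by rewrite (_ : gfun W = tree_fun)//; apply/funext => x; apply/funext.
(* From level [n'] on no factor contains [H n], so [W'] is restricted to a positive cylinder of that
   level. *)
have [n' hn'] := H_leaves n.
have [a nC] : exists a, ~ (gmeas W').-negligible (cyl n' a).
  apply: contrapT => h; apply: nA; apply: (@addr_negligible n') => // a _.
  by rewrite setIC; apply/cA; apply: contrapT => nC; apply: h; exists a.
have [W'' [sW'' cW'']] := restriction_exists (measurable_cyl n' a) nC.
have := QH; rewrite -(wr _ sW'') => /(Q_concentrated x0 (H n) sW''.1 cW'') nnull.
(* One tuple of the cylinder that realizes [H n] suffices for the contradiction. *)
have [s [sn [rs Cs]]] : exists s, size s = gorder (H n) /\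
    realizes_in x0 W' (cyl n' a) (@nat_of_ord _ : H n -> nat) s.
  apply: contrapT => h; apply: nnull; apply: null_false => s sn rs.
  by apply: h; exists s.
(* [tree_fun] takes only the values 0 and 1, so realizing a pair decides its adjacency; equal
   vertices are treated apart. *)
have edgeJ (u v : H n) :
    edge u v <-> joined H (addr ^~ (nth x0 s u)) (addr ^~ (nth x0 s v)).
  have [->|uv] := eqVneq u v.
    by rewrite edge_irr; split=> // -[i]; rewrite level_edge_irr.
  have := rs u v uv; rewrite /= eW' /tree_fun; case: asboolP => hj.
    by case: edge => //; rewrite ltxx.
  by case: edge => //; rewrite ltxx.
have Ca (w : H n) : addr n' (nth x0 s w) = a by apply: Cs; rewrite mem_nth ?sn ?ltn_ord.
have addrE (u v : H n) : addr n' (nth x0 s u) = addr n' (nth x0 s v) by rewrite !Ca.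
have [j jn'] := prime_splits H_gt0 (@H_prime n) (H_gt2 n)
  (fun u => addr_coherent (nth x0 s u)) edgeJ addrE.
exact: hn'.
Qed.

End AddressedSpace.

(** * Mixed-radix digits of real numbers *)

Section UnitInterval.
Variable R : realType.
Variable H : nat -> graph.
Hypothesis H_gt1 : forall n, (1 < gorder (H n))%N.
Let M := level_size H.
Let mu : probability (measurableTypeR R) R := uniform_prob (@ltr01 R).

(** On [[0, 1)] this encodes the first [n] mixed-radix digits; [Num.truncn] sends negative reals to
    0. *)
Definition digit_addr (n : nat) (x : measurableTypeR R) : nat :=
  Num.truncn ((x : R) * (M n)%:R).

Let MR_gt0 n : 0 < (M n)%:R :> R.
Proof. by rewrite ltr0n level_size_gt0// => k; exact: ltnW. Qed.

Lemma truncn_divn (y : R) m : (0 < m)%N ->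
  Num.truncn y = (Num.truncn (y * m%:R) %/ m)%N.
Proof.
move=> m_gt0; have mR : 0 < m%:R :> R by rewrite ltr0n.
have [y0|y0] := leP 0 y; last first.
  have lt1 (z : R) : z < 0 -> Num.truncn z = 0%N.
    by move=> z0; apply/truncn0Pn; rewrite -ltNge (lt_trans z0).
  by rewrite !lt1 ?div0n// pmulr_llt0.
have ym0 : 0 <= y * m%:R by rewrite mulr_ge0// ltW.
have /andP[lo hi] := truncn_itv ym0; set b := Num.truncn (y * m%:R) in lo hi *.
apply/eqP; rewrite truncn_eq//; apply/andP; split.
  rewrite -(ler_pM2r mR); apply: le_trans lo; rewrite -natrM ler_nat.
  exact: leq_divM.
rewrite -(ltr_pM2r mR); apply: lt_le_trans hi _; rewrite -natrM ler_nat.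
by rewrite ltn_ceil.
Qed.

Lemma digit_addr_coherent x : coherent H (digit_addr ^~ x).
Proof.
move=> n; rewrite /digit_addr /M level_sizeS natrM mulrA.
by apply: truncn_divn; exact: ltnW.
Qed.

(** Sublevel sets are half-lines, and level sets are differences of them. *)
Lemma measurable_digit_addr n a : measurable [set x | digit_addr n x = a].
Proof.
have mle b : measurable [set x | (digit_addr n x <= b)%N].
  rewrite (_ : mkset _ = `]-oo, (b.+1%:R / (M n)%:R : R)[%classic); first exact: measurable_itv.
  apply/seteqP; split=> x; rewrite /= in_itv /= /digit_addr truncn_le_nat ltr_pdivlMr//.
case: a => [|a].
  rewrite (_ : mkset _ = [set x | (digit_addr n x <= 0)%N])//.
  by apply/seteqP; split=> x /=; [move=> ->|rewrite leqn0 => /eqP].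
rewrite (_ : mkset _ = [set x | (digit_addr n x <= a.+1)%N] `\` [set x | (digit_addr n x <= a)%N]).
  exact: measurableD.
apply/seteqP; split=> x /=; first by move=> ->; rewrite ltnn.
by move=> [le /negP]; rewrite -ltnNge => lt; apply/eqP; rewrite eqn_leq le.
Qed.

Lemma uniform_prob_digit_addr n a : (a < M n)%N ->
  mu [set x | digit_addr n x = a] = ((M n)%:R^-1)%:E.
Proof.
move=> aM; rewrite /mu /= /uniform_prob integral_uniform_pdf.
set D := _ `&` _.
(* Intersecting with [[0, 1]] removes the negative reals of address 0; the point 1 has address
   [M n], out of range. *)
have -> : D = `[a%:R / (M n)%:R, (a.+1)%:R / (M n)%:R[%classic.
  have aM1 : (a.+1)%:R / (M n)%:R <= 1 :> R by rewrite ler_pdivrMr// mul1r ler_nat.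
  apply/seteqP; split=> x; rewrite /D /= !in_itv /= /digit_addr.
    move=> [xa /andP[x0 x1]].
    have xM0 : 0 <= x * (M n)%:R by rewrite mulr_ge0// ltW.
    by rewrite ler_pdivrMr// ltr_pdivlMr// -truncn_eq// xa.
  move=> /andP[lo hi].
  have x0 : 0 <= x by apply: le_trans lo; rewrite divr_ge0// ltW.
  have xM0 : 0 <= x * (M n)%:R by rewrite mulr_ge0// ltW.
  split; last by rewrite x0 (le_trans (ltW hi)).
  by apply/eqP; rewrite truncn_eq// -ler_pdivrMr// -ltr_pdivlMr// lo.
rewrite (eq_integral (cst 1%:E)) => [|x].
  rewrite integral_cst//= mul1e lebesgue_measure_itv/= lte_fin ltr_pM2r ?invr_gt0//.
  by rewrite ltr_nat ltnSn -EFinB -mulrBl -natrB// subSnn mul1r.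
rewrite inE /= in_itv /= => /andP[lo hi].
have x0 : 0 <= x by apply: le_trans lo; rewrite divr_ge0// ltW.
have x1 : x <= 1.
  by apply: le_trans (ltW hi) _; rewrite ler_pdivrMr// mul1r ler_nat.
by rewrite /uniform_pdf x0 x1 subr0 invr1.
Qed.

Lemma standard_borel_real : standard_borel R (measurableTypeR R).
Proof.
exists id; split=> // A mA; by rewrite image_id.
Qed.

Definition tree_graphon : graphon R (measurableTypeR R) :=
  @Graphon R _ (measurableTypeR R) mu (tree_fun H digit_addr) standard_borel_real
    (addressed_atomless H_gt1 measurable_digit_addr uniform_prob_digit_addr)
    (tree_fun_sym H digit_addr)
    (measurable_tree_fun H measurable_digit_addr) (tree_fun_itv H digit_addr).

End UnitInterval.

(** * From an infinite antichain of primes to a graphon without weakly random subgraphon *)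

Lemma weakly_random_primally_almost_finite (R : realType) (T : universal_theory) :
  closed_under_substitution (models T) ->
  weakly_random_erdos_hajnal R T -> primally_almost_finite (models T).
Proof.
move=> hT wr [G [TG anti]]; have G_gt2 := antichain_order anti.
have G_gt1 k : (1 < gorder (G k))%N by apply: ltnW.
pose H j := G (repeat_index (fun k => gorder (G k)) j).
have H_gt1 n : (1 < gorder (H n))%N by exact: G_gt1.
have H_gt0 n : (0 < gorder (H n))%N by exact: ltnW.
have mcyl := @measurable_digit_addr R H H_gt1.
have mucyl := @uniform_prob_digit_addr R H H_gt1.
have coh := @digit_addr_coherent R H H_gt1.
have TW : is_graphon_of T (tree_graphon R H_gt1).
  exists (level_graph H); split.
    by move=> n; apply: level_graph_models => // k;
      case: (TG (repeat_index (fun k => gorder (G k)) k)).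
  by move=> F; apply: (level_density_cvg H_gt1 mcyl mucyl coh).
have [W' [sW' wW']] := wr _ _ _ TW.
apply: (tree_graphon_not_weakly_random H_gt1 mcyl mucyl coh _ _ _ _ _ _ sW' wW') => //.
- exact: (repeat_prod (g := fun k => gorder (G k)) G_gt1).
- by move=> n; case: (TG (repeat_index (fun k => gorder (G k)) n)).
- by move=> n; exact: G_gt2.
move=> n.
(* From some level on the index of [H n] does not recur, and members of the antichain with other
   indices do not contain it. *)
have [n' hn'] := repeat_index_leaves (g := fun k => gorder (G k)) G_gt1
  (repeat_index (fun k => gorder (G k)) n).
by exists n' => j /hn' h; apply: anti => e; apply: h.
Qed.

Theorem theorem5p4 (R : realType) (T : universal_theory)
  (hT : closed_under_substitution (models T)) :
  weakly_random_erdos_hajnal R T <-> primally_almost_finite (models T).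
Proof.
split; first exact: weakly_random_primally_almost_finite.
exact: primally_almost_finite_weakly_random.
Qed.
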